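(* Let $G$ be a connected, simply connected stratified Lie group of rank $r\ge2$ and step $s\ge2$, of dimension $m$, with Lie algebra $\mathfrak g=\mathfrak g_1\oplus\cdots\oplus\mathfrak g_s$, identified with $\mathbb{R}^m$ by global coordinates in which the identity is $0$. Let $F=\mathbb{R}^n$ be the free nilpotent Lie group of rank $r$ and step $s$, realized by a Hall–Grayson–Grossman basis $Y_1,\dots,Y_n$, with extremal polynomials $P^v_i$ ($v\in\mathbb{R}^n$, $i=1,\dots,n$). Let $\pi:F\to G$ be a surjective Lie group homomorphism with $\pi_*Y_i\in\mathfrak g_1$ for $i=1,\dots,r$. Let $S=\{s_1<\dots<s_m\}\subset\{1,\dots,n\}$ be such that $\{\pi_*Y_s\}_{s\in S}$ is a basis of $\mathfrak g$, set $X_i=\pi_*Y_{s_i}$ ($i=1,\dots,m$, left-invariant vector fields on $G$), and let $\zeta_{ij}\in\mathbb{R}$ be defined by $\pi_*Y_i=\sum_{j=1}^m\zeta_{ij}X_j$ ($i=1,\dots,n$). Let $\gamma:[0,1]\to G$ be horizontal, i.e. Lipschitz with $\dot\gamma=\sum_{j=1}^rh_jX_j(\gamma)$ a.e. for some $h\in L^2([0,1];\mathbb{R}^r)$, with $\gamma(0)=0$, and let $\kappa:[0,1]\to F$ be its lift: $\kappa(0)=0$, $\dot\kappa=\sum_{j=1}^rh_jY_j(\kappa)$ a.e. Suppose $\gamma$ is an extremal with dual curve $\xi$, and let $\lambda_i(t)=\langle\xi(t),X_i(\gamma(t))\rangle$, $i=1,\dots,m$. Then there is $v\in\mathbb{R}^n$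 such that $v_i=\sum_{j=1}^m\zeta_{ij}v_{s_j}$ for all $i=1,\dots,n$, and $\lambda_i(t)=P^v_{s_i}(\kappa(t))$ for all $t\in[0,1]$ and $i=1,\dots,m$.
   Context: Extremal and dual curve (in the fixed coordinates of $G=\mathbb{R}^m$, writing $X_j=\sum_iX_{ji}\partial_{x_i}$): a horizontal $\gamma$ with controls $h$ is an extremal with dual curve $\xi$ if $\xi:[0,1]\to\mathbb{R}^m$ is Lipschitz and there is $\xi_0\in\{0,1\}$ such that (i) $\xi_0+|\xi(t)|\ne0$ for all $t$; (ii) $\xi_0h_j+\langle\xi,X_j(\gamma)\rangle=0$ on $[0,1]$ for $j=1,\dots,r$; (iii) $\dot\xi_k=-\sum_{j=1}^r\sum_{i=1}^m\frac{\partial X_{ji}}{\partial x_k}(\gamma)h_j\xi_i$ a.e. for $k=1,\dots,m$. Multi-indices $\mathcal I=\mathbb{N}^n$: $|\alpha|$, $\alpha!$, $x^\alpha$. Hall basis of the free nilpotent Lie algebra $\mathfrak f$ of rank $r$, step $s$, dimension $n$: take a basis $Y_1,\dots,Y_r$ of the first layer (degree 1); inductively the degree-$d$ basis elements are brackets $[Y_i,Y_j]$ of earlier elements with $i>j$, $d(i)+d(j)=d$, and, if $Y_i$ was constructed as $[Y_h,Y_k]$, then $k\le j$; they are listed after lower-degree elements. Strings: $(\ell)$ for $\ell\le r$; if $Y_\ell=[Y_a,Y_b]$ was so constructed, the string of $a$ followed by $b$. With string $(\ell_0,\dots,\ell_h)$, $I(\ell)_j=\#\{1\le p\le h:\ell_p=j\}$;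 $j\prec\ell$ iff the string of $j$ is an initial segment of that of $\ell$. $[Z,Y_\alpha]$ is the left-nested bracket of $Z$ with $Y_1$ ($\alpha_1$ times), then $Y_2$ ($\alpha_2$ times), ..., $Y_n$ ($\alpha_n$ times). Hall–Grayson–Grossman basis: the vector fields on $\mathbb{R}^n$ $Y_i=\sum_{\ell:\,i\prec\ell}\frac{(-1)^{|I(\ell)|}}{I(\ell)!}x^{I(\ell)}\partial_{x_\ell}$ ($i\le r$) and $Y_\ell=[Y_a,Y_b]$ (vector field bracket) for $\ell>r$ constructed as $[Y_a,Y_b]$; they are the left-invariant vector fields of a free nilpotent group structure on $\mathbb{R}^n$ with identity $0$, this group being $F$. Generalized structure constants: $[Y_i,Y_\alpha]=\sum_kc^k_{i\alpha}Y_k$. Extremal polynomials: $P^v_i(x)=\sum_{\alpha\in\mathcal I}\frac{(-1)^{|\alpha|}}{\alpha!}\big(\sum_kc^k_{i\alpha}v_k\big)x^\alpha$. *)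

(* Defs.v *)
From HB Require Import structures.
From mathcomp Require Import all_boot all_order all_algebra.
From mathcomp Require Import all_classical all_reals all_analysis.
Unset Implicit Arguments. Unset Strict Implicit. Unset Printing Implicit Defensive.
Import Order.TTheory GRing.Theory Num.Theory.
Import numFieldNormedType.Exports.
Local Open Scope ring_scope.

Section Defs.
Context {R : realType}.

Definition iterD {V W : normedModType R} (l : seq V) (f : V -> W) : V -> W :=
  foldr (fun v g => fun x => 'D_v g x) f l.

Definition smooth {V W : normedModType R} (f : V -> W) : Prop :=
  forall (l : seq V) (x : V), differentiable (iterD l f) x.

Definition lie_group_law {k : nat} (mul : 'rV[R]_k -> 'rV[R]_k -> 'rV[R]_k)
    (inv : 'rV[R]_k -> 'rV[R]_k) : Prop :=
  [/\ forall x y z, mul x (mul y z) = mul (mul x y) z,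
      forall x, mul 0 x = x /\ mul x 0 = x,
      forall x, mul (inv x) x = 0 /\ mul x (inv x) = 0,
      smooth (fun z : 'rV[R]_(k + k) => mul (lsubmx z) (rsubmx z))
    & smooth inv].

Definition vfield (k : nat) := 'rV[R]_k -> 'rV[R]_k.

Definition linv {k : nat} (mul : 'rV[R]_k -> 'rV[R]_k -> 'rV[R]_k)
    (w : 'rV[R]_k) : vfield k :=
  fun g => 'D_w (mul g) 0.

Definition vfbr {k : nat} (X Y : vfield k) : vfield k :=
  fun p => 'D_(X p) Y p - 'D_(Y p) X p.

(* Lie bracket on the Lie algebra, identified with the tangent space at 0 *)
Definition lie_br {k : nat} (mul : 'rV[R]_k -> 'rV[R]_k -> 'rV[R]_k)
    (w1 w2 : 'rV[R]_k) : 'rV[R]_k :=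
  vfbr (linv mul w1) (linv mul w2) 0.

(* V 0, ..., V (s-1) is a stratification g = g_1 (+) ... (+) g_s of rank r,
   step s (layer g_(k+1) is V k) *)
Definition stratification {m : nat} (r s : nat)
    (mul : 'rV[R]_m -> 'rV[R]_m -> 'rV[R]_m) (V : nat -> {vspace 'rV[R]_m}) :=
  [/\ directv (\sum_(k < s) V k)%VS /\
      (\sum_(k < s) V k)%VS = fullv,
      \dim (V 0%N) = r,
      V (s.-1) != 0%VS,
      forall k, (k.+1 < s)%N -> forall U : {vspace 'rV[R]_m},
        (V k.+1 <= U)%VS <->
        (forall a b, a \in V 0%N -> b \in V k -> lie_br mul a b \in U)
    & forall a b, a \in V 0%N -> b \in V (s.-1) -> lie_br mul a b = 0].

(* indices 0..r-1 : first layer; for r <= l < n, Y_l = [Y_a, Y_b] with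
   (a, b) = par l; deg l is the degree *)
Definition hall_basis (r s n : nat) (deg : nat -> nat) (par : nat -> nat * nat) :=
  [/\ forall l, (l < r)%N -> deg l = 1%N,
      forall l, (r <= l < n)%N ->
        [/\ ((par l).2 < (par l).1 < n)%N,
            deg l = (deg (par l).1 + deg (par l).2)%N
          & (r <= (par l).1)%N -> ((par (par l).1).2 <= (par l).2)%N],
      forall l, (l < n)%N -> (deg l <= s)%N,
      forall i j, (i <= j < n)%N -> (deg i <= deg j)%N
    & forall a b, (b < a < n)%N -> (deg a + deg b <= s)%N ->
        ((a < r)%N \/ ((par a).2 <= b)%N) ->
        exists! l, (r <= l < n)%N /\ par l = (a, b)].

Fixpoint hstring_aux (r : nat) (par : nat -> nat * nat) (fuel l : nat)
  : seq nat :=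
  match fuel with
  | 0 => [::]
  | f.+1 => if (l < r)%N then [:: l]
            else rcons (hstring_aux r par f (par l).1) (par l).2
  end.

Definition hstring (r : nat) (par : nat -> nat * nat) (l : nat) := hstring_aux r par l.+1 l.

Definition Iidx (n r : nat) (par : nat -> nat * nat) (l : nat) : {ffun 'I_n -> nat} :=
  [ffun j : 'I_n => count_mem (val j) (behead (hstring r par l))].

Definition mabs {n : nat} (a : {ffun 'I_n -> nat}) : nat := (\sum_(j < n) a j)%N.
Definition mfact {n : nat} (a : {ffun 'I_n -> nat}) : R := \prod_(j < n) ((a j)`!)%:R.
Definition mono {n : nat} (x : 'rV[R]_n) (a : {ffun 'I_n -> nat}) : R :=
  \prod_(j < n) x 0 j ^+ a j.

Definition hgg_gen (n r : nat) (par : nat -> nat * nat) (i : nat) : vfield n :=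
  fun x => \sum_(l < n | prefix (hstring r par i) (hstring r par l))
     ((-1) ^+ mabs (Iidx n r par l) / mfact (Iidx n r par l)
        * mono x (Iidx n r par l)) *: delta_mx 0 l.

Fixpoint hgg_aux (n r : nat) (par : nat -> nat * nat) (fuel l : nat) : vfield n :=
  match fuel with
  | 0 => fun _ => 0
  | f.+1 => if (l < r)%N then hgg_gen n r par l
            else vfbr (hgg_aux n r par f (par l).1) (hgg_aux n r par f (par l).2)
  end.

Definition hgg (n r : nat) (par : nat -> nat * nat) (l : nat) : vfield n := hgg_aux n r par l.+1 l.

Definition nestbr {n : nat} (Y : nat -> vfield n) (Z : vfield n)
    (a : {ffun 'I_n -> nat}) : vfield n :=
  foldl (fun W (j : 'I_n) => iter (a j) (fun W' => vfbr W' (Y j)) W) Z (enum 'I_n).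

Definition struct_consts {n : nat} (Y : nat -> vfield n)
    (c : nat -> {ffun 'I_n -> nat} -> nat -> R) : Prop :=
  forall i a, (i < n)%N ->
    nestbr Y (Y i) a = (fun x => \sum_(k < n) c i a k *: Y k x).

Definition extremal_poly {n : nat} (c : nat -> {ffun 'I_n -> nat} -> nat -> R)
    (v : nat -> R) (i : nat) (x : 'rV[R]_n) : R :=
  (\sum_(a \in [set: {ffun 'I_n -> nat}])
     ((-1) ^+ mabs a / mfact a * (\sum_(k < n) c i a k * v k) * mono x a))%R.

Definition lipschitz01 {k : nat} (f : R -> 'rV[R]_k) : Prop :=
  exists L : R, forall t u, t \in `[0, 1] -> u \in `[0, 1] ->
    `|f t - f u| <= L * `|t - u|.

Definition L2_01 (f : R -> R) : Prop :=
  measurable_fun (`[0%R, 1%R]%classic : set R) f /\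
  (\int[@lebesgue_measure R]_(t in `[0%R, 1%R]%classic) ((f t) ^+ 2)%:E < +oo)%E.

Definition dotv {k : nat} (u w : 'rV[R]_k) : R := \sum_(i < k) u 0 i * w 0 i.

End Defs.

(* Main.v *)
(* Let [e_k] be the canonical basis of R^n, [W_k] the left-invariant field of G whose
   value at the identity is the image of [e_k] under the differential of [pi] at 0,
   and [mu_k(t) = <xi(t), W_k(gamma(t))>]. Since [W_k] is related by [pi] to [Y_k], the adjoint
   equation reads [mu' = - sum_j h_j C_j mu], where [C_j] is the matrix of
   [u |-> [u, e_j]] in the free Lie algebra. We take [v = mu(0)].

   Let [B(x)] be the matrix of [Ad(x^-1)] on F, which expresses right-invariant
   fields in the left-invariant frame. As right- and left-invariant fields commute,
   [Y_j B = B C_j], so [B(kappa) mu] has derivative zero almost everywhere; being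
   Lipschitz it is constant, that is [mu = B(kappa)^-1 v].

   It remains to see that [B(x)^-1 v] is the extremal polynomial. On the slice
   [x_1 = ... = x_(l-1) = 0] the Hall-Grayson-Grossman field [Y_l] is the coordinate
   field [d/dx_l]. Integrating [Y_l B = B C_l] along the coordinate lines of these
   slices gives [B(x)^-1 = exp(-x_1 C_1) ... exp(-x_n C_n)], whose expansion is the
   sum defining the extremal polynomials; it is finite because the fields are
   homogeneous for the dilations, which makes each [C_j] raise degrees. *)

Require Import Defs.
From HB Require Import structures.
From mathcomp Require Import all_boot all_order all_algebra.
From mathcomp Require Import all_classical all_reals all_analysis.
From mathcomp Require Import measurable_realfun ring lra.
Import Order.TTheory GRing.Theory Num.Theory.
Import numFieldNormedType.Exports.
Set Implicit Arguments. Unset Strict Implicit. Unset Printing Implicit Defensive.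
Local Open Scope classical_set_scope.
Local Open Scope ring_scope.

(** * Directional derivatives *)

Section DirectionalDerivatives.
Context {R : realType}.
Implicit Types (U V W : normedModType R).

(** The controls are merely square integrable, so solving the equation of mu would call for
    uniqueness of solutions with measurable coefficients. A conserved quantity avoids this: a
    covering argument on the line is enough. The curves gamma and kappa are tied only by their
    controls: at almost every time both are steered by the same element a = sum_j h_j Y_j, one
    through F and the other through its image in G. This requires X_j to be the image of Y_j for
    every j < r, that is s_j = j, although S is only assumed to index a basis. A dimension count
    gives it: images of proper brackets lie in the layers of degree at least two, which have
    codimension r. Taking mu over all n indices of F, not only the m indices in S, makes the
    relation between v and zeta a plain pairing of xi(0) with an identity of fields. No formula for
    the group law of F is at hand. It enters through its axioms and the left invariance of the Y_l,
    which is why slices and dilations are studied on the fields alone. *)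

Lemma derive_comp U V W (f : U -> V) (g : V -> W) x v :
  differentiable f x -> differentiable g (f x) ->
  'D_v (fun y => g (f y)) x = 'D_('D_v f x) g (f x).
Proof.
move=> df dg; rewrite (deriveE v df) (deriveE _ dg).
rewrite deriveE; last exact: differentiable_comp.
by rewrite (diff_comp df dg).
Qed.

Lemma derive_comp_line V W (f : V -> W) (p : R -> V) (t : R) (v : V) :
  is_derive t 1 p v -> differentiable f (p t) ->
  is_derive t 1 (fun u => f (p u)) ('D_v f (p t)).
Proof.
move=> [dp <-] df.
have dp' : differentiable p t by apply/derivable1_diffP.
apply: DeriveDef; last exact: derive_comp.
exact/diff_derivable/differentiable_comp.
Qed.

Lemma deriveDr V W (f : V -> W) x u v : differentiable f x ->
  'D_(u + v) f x = 'D_u f x + 'D_v f x.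
Proof. by move=> df; rewrite !deriveE// linearD. Qed.

Lemma deriveZr V W (f : V -> W) x a u : differentiable f x ->
  'D_(a *: u) f x = a *: 'D_u f x.
Proof. by move=> df; rewrite !deriveE// linearZ. Qed.

Lemma deriveNr V W (f : V -> W) x u : differentiable f x ->
  'D_(- u) f x = - 'D_u f x.
Proof. by move=> df; rewrite !deriveE// linearN. Qed.

Lemma derive_sumr V W (f : V -> W) x (I : Type) (r : seq I) (P : pred I)
    (u : I -> V) : differentiable f x ->
  'D_(\sum_(i <- r | P i) u i) f x = \sum_(i <- r | P i) 'D_(u i) f x.
Proof.
by move=> df; rewrite deriveE// linear_sum; apply: eq_bigr => i _; rewrite deriveE.
Qed.

Lemma derive_row k W (f : 'rV[R]_k -> W) x u : differentiable f x ->
  'D_u f x = \sum_(i < k) u 0 i *: 'D_(delta_mx 0 i) f x.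
Proof.
move=> df; rewrite {1}(row_sum_delta u) derive_sumr//.
by apply: eq_bigr => i _; rewrite deriveZr.
Qed.

Lemma derive_coord V k (f : V -> 'rV[R]_k) x v i :
  derivable f x v -> ('D_v f x) 0 i = 'D_v (fun y => f y 0 i) x.
Proof. by move=> df; rewrite derive_mx// mxE. Qed.

Lemma diff_derive_coord V k (f : V -> 'rV[R]_k) x v i :
  differentiable f x -> ('D_v f x) 0 i = 'D_v (fun y => f y 0 i) x.
Proof. by move=> df; rewrite derive_coord//; exact: diff_derivable. Qed.

Lemma derivable_coord V k (f : V -> 'rV[R]_k) x v i :
  derivable f x v -> derivable (fun y => f y 0 i) x v.
Proof. by move/derivable_mxP/(_ 0 i). Qed.

Lemma differentiable_rowP V k (f : V -> 'rV[R]_k) x :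
  differentiable f x <-> forall i, differentiable (fun y => f y 0 i) x.
Proof.
split=> [df i|df].
  exact: (differentiable_comp df (differentiable_coord _ _ _)).
rewrite (_ : f = \sum_(i < k) (fun y => f y 0 i *: delta_mx 0 i)); last first.
  by apply/funext => y; rewrite fct_sumE -row_sum_delta.
by apply: differentiable_sum => i; exact: differentiableZl.
Qed.

Lemma differentiable_scale V k (g : V -> R) (f : V -> 'rV[R]_k) x :
  differentiable g x -> differentiable f x ->
  differentiable (fun y => g y *: f y) x.
Proof.
move=> dg /differentiable_rowP df; apply/differentiable_rowP => i.
rewrite (_ : (fun _ => _) = g * (fun y => f y 0 i)).
  exact: differentiableM.
by apply/funext => y; rewrite mxE.
Qed.

Lemma derive_scale V k (g : V -> R) (f : V -> 'rV[R]_k) x v :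
  differentiable g x -> differentiable f x ->
  'D_v (fun y => g y *: f y) x = g x *: 'D_v f x + 'D_v g x *: f x.
Proof.
move=> dg df; apply/rowP => i.
rewrite derive_coord; last exact/diff_derivable/differentiable_scale.
rewrite (_ : (fun _ => _) = g * (fun y => f y 0 i)); last first.
  by apply/funext => y; rewrite mxE.
have dfi : derivable (fun y => f y 0 i) x v.
  exact/derivable_coord/diff_derivable.
rewrite deriveM//; last exact: diff_derivable.
rewrite !mxE derive_coord//; last exact: diff_derivable.
by congr (_ + _); exact: mulrC.
Qed.

Lemma diff_deriveZ V W (f : V -> W) (a : R) x v : differentiable f x ->
  'D_v (fun y => a *: f y) x = a *: 'D_v f x.
Proof. by move=> df; rewrite -deriveZ//; exact: diff_derivable. Qed.

Lemma differentiable_bound V W (f : V -> W) x : differentiable f x ->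
  forall e, 0 < e -> exists2 d, 0 < d &
  forall z, `|z| < d -> `|f (x + z) - f x - 'D_z f x| <= e * `|z|.
Proof.
move=> df e e0; have /eqaddoP/(_ e e0) := diff_locally df.
move=> /nbhs_normP[d /= d0 H]; exists d => // z zd.
rewrite (deriveE _ df); have := H z; rewrite /ball_ /= sub0r normrN => /(_ zd).
move=> HH; rewrite [x + z]addrC -addrA -opprD; exact: HH.
Qed.

Lemma is_derive_line V W (f : V -> W) (x u : V) (t : R) :
  differentiable f (x + t *: u) ->
  is_derive t 1 (fun s : R => f (x + s *: u)) ('D_u f (x + t *: u)).
Proof.
move=> df; have dl : is_derive t 1 (fun s : R => x + s *: u) u.
  have ds : is_derive t 1 ( *:%R^~ u) u.
    apply: DeriveDef; first exact: diff_derivable.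
    by rewrite deriveE// diff_val scale1r.
  by apply: is_derive_eq; rewrite add0r.
exact: derive_comp_line.
Qed.

End DirectionalDerivatives.

(** * Symmetry of second derivatives and brackets of vector fields *)

Section SecondDerivatives.
Context {R : realType}.

(** Second derivatives need not be continuous: differentiability of the first ones already makes
    mixed derivatives commute. *)
Definition twice_diff {V W : normedModType R} (f : V -> W) :=
  (forall x, differentiable f x) /\
  (forall v x, differentiable (fun y => 'D_v f y) x).

(* The second difference quotient [D(h) / h^2], with
   [D(h) = f(x+hu+hv) - f(x+hu) - f(x+hv) + f(x)], is close to [D_v D_u f(x)]
   by the mean value theorem along [u]; it is symmetric in [u] and [v]. *)
Lemma second_difference (V : normedModType R) (f : V -> R) (x u v : V) (e : R) :
  twice_diff f -> 0 < e -> exists2 d, 0 < d & forall h : R, 0 < h -> h < d ->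
  `|f (x + h *: u + h *: v) - f (x + h *: u) - f (x + h *: v) + f x
    - h ^+ 2 * 'D_v (fun y => 'D_u f y) x| <= e * h ^+ 2.
Proof.
move=> [df ddf] e0; set g : V -> R := fun y => 'D_u f y.
(* The two first-order expansions below have increments of size at most [h (|u| + |v|)] and [h |u|];
   [K] dominates their sum divided by [h], and the 1 keeps it positive. *)
pose K : R := 2 * (`|u| + `|v|) + 1.
have K0 : 0 < K by rewrite ltr_wpDl// mulr_ge0// addr_ge0.
have [d d0 dP] := differentiable_bound (ddf u x) (divr_gt0 e0 K0).
exists (d / K); first exact: divr_gt0.
move=> h h0; rewrite ltr_pdivlMr// => hd.
pose F (s : R) : R := f ((x + h *: v) + s *: u) - f (x + s *: u).
pose dF (s : R) : R := g ((x + h *: v) + s *: u) - g (x + s *: u).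
have Fd (s : R) : is_derive s 1 F (dF s).
  by apply: is_deriveB; apply: is_derive_line.
have Fc : {within `[0, h], continuous F}.
  by apply: derivable_within_continuous => s _; exact: ex_derive.
have [c /[!in_itv]/= /andP[c0 ch]] := MVT h0 (fun s _ => Fd s) Fc.
rewrite subr0 /F !scale0r !addr0 => E.
have -> : f (x + h *: u + h *: v) - f (x + h *: u) - f (x + h *: v) + f x
    = dF c * h.
  by rewrite -E (addrAC x (h *: v)); ring.
have nu : `|c *: u| <= h * `|u|.
  by rewrite normrZ ler_wpM2r// ger0_norm ltW.
have nv : `|h *: v| = h * `|v| by rewrite normrZ gtr0_norm.
have hn1 : `|h *: v + c *: u| <= h * (`|u| + `|v|).
  by rewrite (le_trans (ler_normD _ _))// nv mulrDr addrC lerD2r.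
have b1 : h * (`|u| + `|v|) < d.
  apply: le_lt_trans hd; rewrite ler_wpM2l ?ltW// /K.
  by have := normr_ge0 u; have := normr_ge0 v; lra.
have b2 : h * `|u| < d.
  by apply: le_lt_trans b1; rewrite ler_wpM2l ?lerDl// ltW.
have e1 := dP _ (le_lt_trans hn1 b1).
have e2 := dP _ (le_lt_trans nu b2).
rewrite (deriveDr _ _ (ddf u x)) (deriveZr _ _ (ddf u x)) in e1.
have -> : dF c * h - h ^+ 2 * 'D_v g x = h * (
   (g (x + (h *: v + c *: u)) - g x - (h *: 'D_v g x + 'D_(c *: u) g x))
   - (g (x + c *: u) - g x - 'D_(c *: u) g x)).
  rewrite /dF addrA (_ : h *: _ = h * 'D_v g x)//.
  move: (g _) (g (x + c *: u)) (g x) ('D_v g x) ('D_(c *: u) g x) => a1 a2 a3 a4 a5.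
  ring.
rewrite normrM gtr0_norm// expr2 mulrCA ler_wpM2l ?(ltW h0)//.
apply: (le_trans (ler_normB _ _)).
have a1 := le_trans e1 (ler_wpM2l (ltW (divr_gt0 e0 K0)) hn1).
have a2 := le_trans e2 (ler_wpM2l (ltW (divr_gt0 e0 K0)) nu).
apply: (le_trans (lerD a1 a2)).
have -> : e / K * (h * (`|u| + `|v|)) + e / K * (h * `|u|)
    = e * h * ((`|u| + `|v| + `|u|) / K) by ring.
rewrite ler_piMr ?mulr_ge0 ?(ltW h0) ?(ltW e0)// ler_pdivrMr// mul1r /K.
by have := normr_ge0 u; have := normr_ge0 v; lra.
Qed.

Lemma derive_symm_real (V : normedModType R) (f : V -> R) x u v :
  twice_diff f -> 'D_v (fun y => 'D_u f y) x = 'D_u (fun y => 'D_v f y) x.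
Proof.
move=> ff; apply/eqP; rewrite -subr_eq0 -normr_le0; apply/ler_addgt0Pr => e e0.
rewrite add0r; have e20 : 0 < e / 2 by rewrite divr_gt0.
have [d1 d10 P1] := second_difference x u v ff e20.
have [d2 d20 P2] := second_difference x v u ff e20.
pose h := Num.min d1 d2 / 2.
have m0 : 0 < Num.min d1 d2 by rewrite lt_min d10.
have h0 : 0 < h by rewrite divr_gt0.
have hm : h < Num.min d1 d2 by rewrite gtr_pMr// invf_lt1// ltr1n.
move: hm; rewrite lt_min => /andP[hd1 hd2].
have := P1 _ h0 hd1; have := P2 _ h0 hd2.
rewrite (addrAC x (h *: v)) (addrAC (f _)).
set A := 'D_u _ x; set B := 'D_v _ x; set D := _ - _ - _ + _ => e1 e2.
have h20 : 0 < h ^+ 2 by rewrite exprn_gt0.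
rewrite -(ler_pM2r h20) -[h ^+ 2 in leLHS](gtr0_norm h20) -normrM.
have -> : (B - A) * h ^+ 2 = (D - h ^+ 2 * A) - (D - h ^+ 2 * B) by ring.
by rewrite (le_trans (ler_normB _ _))// (le_trans (lerD e1 e2))// -mulrDl -splitr.
Qed.

Lemma twice_diff_coord (V : normedModType R) k (f : V -> 'rV[R]_k) i :
  twice_diff f -> twice_diff (fun y => f y 0 i : R).
Proof.
move=> [df ddf]; split=> [x|v x]; first by have /differentiable_rowP := df x.
rewrite (_ : (fun _ => _) = (fun y => ('D_v f y) 0 i)).
  by have /differentiable_rowP := ddf v x.
by apply/funext => y; rewrite derive_coord//; exact: diff_derivable.
Qed.

Lemma derive_symm (V : normedModType R) k (f : V -> 'rV[R]_k) x u v :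
  twice_diff f -> 'D_v (fun y => 'D_u f y) x = 'D_u (fun y => 'D_v f y) x.
Proof.
move=> ff; have [df ddf] := ff; apply/rowP => i.
apply: etrans (diff_derive_coord v i (ddf u x)) _.
apply/esym/(etrans (diff_derive_coord u i (ddf v x)))/esym.
have E w : (fun y => ('D_w f y) 0 i) = (fun y => 'D_w (fun z => f z 0 i : R) y).
  by apply/funext => y; rewrite derive_coord//; exact: diff_derivable.
rewrite (E u); apply: etrans (derive_symm_real _ _ _ (twice_diff_coord i ff)) _.
by rewrite -(E v).
Qed.

Lemma differentiable_deriveX (V : normedModType R) k j
    (f : 'rV[R]_j -> 'rV[R]_k) (X : V -> 'rV[R]_j) (p : V -> 'rV[R]_j) x :
  twice_diff f -> differentiable X x -> differentiable p x ->
  differentiable (fun y => 'D_(X y) f (p y)) x.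
Proof.
move=> [df ddf] dX dp.
rewrite (_ : (fun _ => _) =
    \sum_(i < j) (fun y => X y 0 i *: 'D_(delta_mx 0 i) f (p y))).
  apply: differentiable_sum => i; apply: differentiable_scale.
    by move/differentiable_rowP: dX.
  exact: (differentiable_comp dp (ddf _ _)).
by apply/funext => y; rewrite derive_row// fct_sumE.
Qed.

(** Expanding [X] in coordinates turns the pairing of the differential of [f] with [X] into scalar
    products, to which the product and chain rules apply. *)
Lemma derive_deriveX (V : normedModType R) k j
    (f : 'rV[R]_j -> 'rV[R]_k) (X : V -> 'rV[R]_j) (p : V -> 'rV[R]_j) x v :
  twice_diff f -> differentiable X x -> differentiable p x ->
  'D_v (fun y => 'D_(X y) f (p y)) x =
  'D_('D_v X x) f (p x) + 'D_('D_v p x) (fun y => 'D_(X x) f y) (p x).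
Proof.
move=> ff dX dp; have [df ddf] := ff.
rewrite [in LHS](_ : (fun _ => _) =
    \sum_(i < j) (fun y => X y 0 i *: 'D_(delta_mx 0 i) f (p y))); last first.
  by apply/funext => y; rewrite derive_row// fct_sumE.
have dXi i : differentiable (fun y => X y 0 i) x by move/differentiable_rowP: dX.
have dfp i : differentiable (fun y => 'D_(delta_mx 0 i) f (p y)) x.
  exact: (differentiable_comp dp (ddf _ _)).
rewrite derive_sum; last by move=> i; apply/diff_derivable/differentiable_scale.
rewrite [in RHS](derive_row _ (df _)).
rewrite (_ : (fun y => 'D_(X x) f y) =
   \sum_(i < j) (fun y => X x 0 i *: 'D_(delta_mx 0 i) f y)); last first.
  by apply/funext => y; rewrite derive_row// fct_sumE.
rewrite derive_sum; last by move=> i; apply/derivableZ/diff_derivable.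
rewrite -big_split; apply: eq_bigr => i _ /=.
apply: etrans (derive_scale _ (dXi i) (dfp i)) _; rewrite [RHS]addrC; congr (_ + _); last first.
  by congr (_ *: _); exact/esym/diff_derive_coord.
apply: etrans _ (esym (diff_deriveZ _ _ (ddf _ _))).
apply: (congr1 (fun z => _ *: z)).
exact: (@derive_comp _ _ _ _ p (fun y => 'D_(delta_mx 0 i) f y) x v
  dp (ddf _ _)).
Qed.

(** Both iterated derivatives contain the same second-order term, by symmetry; after cancellation
    only the derivative along the bracket is left. *)
Lemma vfbrE k j (f : 'rV[R]_j -> 'rV[R]_k) (X Y : vfield j) x :
  twice_diff f -> differentiable X x -> differentiable Y x ->
  'D_(vfbr X Y x) f x =
  'D_(X x) (fun y => 'D_(Y y) f y) x - 'D_(Y x) (fun y => 'D_(X y) f y) x.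
Proof.
move=> ff dX dY; have [df ddf] := ff.
have gen (a b z : 'rV[R]_k) : a - b = (a + z) - (b + z).
  by rewrite opprD addrACA subrr addr0.
have did : differentiable (fun y : 'rV[R]_j => y) x by exact: ex_diff.
pose S u v := 'D_u (fun y => 'D_v f y) x.
have E (A B : vfield j) : differentiable B x ->
    'D_(A x) (fun y => 'D_(B y) f y) x
    = 'D_('D_(A x) B x) f x + S (A x) (B x).
  by move=> dB; apply: etrans (derive_deriveX _ ff dB did) _; rewrite derive_id.
have SE : S (Y x) (X x) = S (X x) (Y x) by exact: derive_symm.
apply: etrans _ (esym (congr2 (fun a b => a - b) (E X Y dY)
  (etrans (E Y X dX) (congr1 _ SE)))).
clearbody S; rewrite [in LHS](_ : vfbr X Y x = 'D_(X x) Y x + - 'D_(Y x) X x)//.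
rewrite (deriveDr _ _ (df x)) (deriveNr _ (df x)).
exact: gen.
Qed.

(** Relatedness turns each inner derivative of [f] into a field composed with [f], so the commutator
    formula in the source becomes the bracket in the target. It serves for left translations and for
    [pi]. *)
Lemma vfbr_related k j (f : 'rV[R]_j -> 'rV[R]_k) (X Y : vfield j)
    (X' Y' : vfield k) x :
  twice_diff f -> differentiable X x -> differentiable Y x ->
  differentiable X' (f x) -> differentiable Y' (f x) ->
  (forall y, 'D_(X y) f y = X' (f y)) -> (forall y, 'D_(Y y) f y = Y' (f y)) ->
  'D_(vfbr X Y x) f x = vfbr X' Y' (f x).
Proof.
move=> ff dX dY dX' dY' rX rY; have [df _] := ff.
apply: etrans (vfbrE ff dX dY) _; apply: (congr2 (fun a b => a - b)).
  rewrite (_ : (fun y => 'D_(Y y) f y) = (fun y => Y' (f y))); last exact/funext.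
  by apply: etrans (derive_comp _ (df x) dY') _; rewrite rX.
rewrite (_ : (fun y => 'D_(X y) f y) = (fun y => X' (f y))); last exact/funext.
by apply: etrans (derive_comp _ (df x) dX') _; rewrite rY.
Qed.

(** The commutator formula is applied to the fields themselves, seen as vector-valued maps;
    everything becomes iterated derivatives, which cancel formally. *)
Lemma vfbr_jacobi k (X Y Z : vfield k) x :
  twice_diff (X : 'rV[R]_k -> 'rV[R]_k) -> twice_diff (Y : 'rV[R]_k -> 'rV[R]_k) ->
  twice_diff (Z : 'rV[R]_k -> 'rV[R]_k) ->
  vfbr (vfbr X Y) Z x = vfbr X (vfbr Y Z) x - vfbr Y (vfbr X Z) x.
Proof.
move=> tX tY tZ; have [[dX _] [dY _] [dZ _]] := And3 tX tY tZ.
have dd (A B : vfield k) : twice_diff (A : 'rV[R]_k -> 'rV[R]_k) ->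
    twice_diff (B : 'rV[R]_k -> 'rV[R]_k) ->
    differentiable (fun y => 'D_(A y) B y) x.
  by move=> [dA _] tB; apply: (differentiable_deriveX tB).
have dv (A B C : vfield k) : twice_diff (A : 'rV[R]_k -> 'rV[R]_k) ->
    twice_diff (B : 'rV[R]_k -> 'rV[R]_k) ->
    'D_(C x) (vfbr A B) x = 'D_(C x) (fun y => 'D_(A y) B y) x
      - 'D_(C x) (fun y => 'D_(B y) A y) x.
  by move=> tA tB; rewrite deriveB//; apply/diff_derivable/dd.
have gen (a b c d e f : 'rV[R]_k) :
    a - b - (c - d) = a - e - (f - d) - (b - f - (e - c)).
  by apply/rowP => i; rewrite !mxE; ring.
pose sub (a b : 'rV[R]_k) := a - b.
have -> : vfbr (vfbr X Y) Z x = sub ('D_(vfbr X Y x) Z x) ('D_(Z x) (vfbr X Y) x).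
  by [].
have -> : vfbr X (vfbr Y Z) x = sub ('D_(X x) (vfbr Y Z) x) ('D_(vfbr Y Z x) X x).
  by [].
have -> : vfbr Y (vfbr X Z) x = sub ('D_(Y x) (vfbr X Z) x) ('D_(vfbr X Z x) Y x).
  by [].
apply: etrans (congr2 sub (vfbrE tZ (dX x) (dY x)) (dv X Y Z tX tY)) _.
apply: etrans (gen _ _ _ _ _ _) _; apply: (congr2 sub).
  exact: esym (congr2 sub (dv Y Z X tY tZ) (vfbrE tX (dY x) (dZ x))).
exact: esym (congr2 sub (dv X Z Y tX tZ) (vfbrE tY (dX x) (dZ x))).
Qed.

End SecondDerivatives.

(** * Lipschitz functions with derivative zero almost everywhere *)

Section LipschitzCurves.
Context {R : realType}.

(** Real induction: the supremum of the points reached from [a] is itself reached, and if it were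
    below [b] one more local step would pass it. *)
Lemma interval_chain (P : R -> R -> Prop) (a b : R) : a <= b -> P a a ->
  (forall x y z, P x y -> P y z -> P x z) ->
  (forall t, a <= t <= b -> exists2 d, 0 < d & forall u, a <= u <= b ->
     `|u - t| < d -> (t <= u -> P t u) /\ (u <= t -> P u t)) ->
  P a b.
Proof.
move=> ab Paa Ptr Ploc.
pose S := [set t | a <= t <= b /\ P a t].
have Sa : S a by rewrite /S/= lexx ab.
have Sub : ubound S b by move=> t [/andP[_ tb] _].
have Ssup : has_sup S by split; [exists a|exists b].
have sab : a <= sup S <= b.
  by rewrite (ub_le_sup _ Sa) ?ge_sup//; [exists a|exists b].
have [d d0 dP] := Ploc _ sab.
have Ps : P a (sup S).
  have [t St tlt] := sup_adherent d0 Ssup.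
  have ts : t <= sup S by apply: (ub_le_sup _ St); exists b.
  have [tab Pt] := St.
  apply: Ptr Pt _; apply: (dP _ tab _).2 => //.
  by rewrite distrC ger0_norm ?subr_ge0// ltrBlDr -ltrBlDl.
have [->//|sb] := eqVneq b (sup S).
have slt : sup S < b by rewrite lt_neqAle eq_sym sb; case/andP: sab.
pose u := Num.min b (sup S + d / 2).
have su : sup S < u by rewrite lt_min slt ltrDl divr_gt0.
have uab : a <= u <= b by rewrite ge_min lexx andbT (le_trans _ (ltW su))//; case/andP: sab.
have Pu : P (sup S) u.
  apply: (dP _ uab _).1; last exact: ltW.
  rewrite gtr0_norm ?subr_gt0// ltrBlDl gt_min; apply/orP; right.
  by rewrite ltrD2l gtr_pMr// invf_lt1// ltr1n.
have /(ub_le_sup _) : S u by split=> //; exact: Ptr Pu.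
by move=> /(_ (ex_intro _ b Sub)); rewrite leNgt su.
Qed.

(* Cover the exceptional null set by an open [U] of measure less than [e]; then
   [|f t - f 0| <= e t + L |U `&` [0, t]|] propagates from 0 to [t]. *)
Lemma lipschitz_ae_derive0 (f : R -> R) (L : R) :
  (forall t u, t \in `[0, 1] -> u \in `[0, 1] -> `|f t - f u| <= L * `|t - u|) ->
  {ae @lebesgue_measure R, forall t : R, t \in `[0, 1] -> is_derive t 1 f 0} ->
  forall t, t \in `[0, 1] -> f t = f 0.
Proof.
move=> Lf [A [mA A0 sA]].
have L0 : 0 <= L.
  have := Lf 0 1; rewrite !in_itv/= !lexx !ler01 sub0r normrN normr1 mulr1.
  by move=> /(_ isT isT); exact: le_trans.
(* One [e] plays two parts, as tolerated slope outside [U] and as bound on the measure of [U]; both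
   errors vanish with it. *)
suff key e t : 0 < e -> 0 <= t <= 1 -> `|f t - f 0| <= e * t + L * e.
  move=> t /[!in_itv]/= t01; apply/eqP; rewrite -subr_eq0 -normr_le0.
  apply/ler_addgt0Pr => e e0; rewrite add0r.
  have e0' : 0 < e / (1 + L) by rewrite divr_gt0// ltr_wpDr.
  apply: (le_trans (key _ _ e0' t01)).
  rewrite [leRHS](_ : e = e / (1 + L) * (1 + L)); last first.
    by rewrite divfK// gt_eqF// ltr_wpDr.
  rewrite [_ * (1 + L)]mulrDr mulr1 [L * _]mulrC lerD2r.
  by rewrite ler_piMr ?(ltW e0')//; case/andP: t01.
move=> e0 t01.
have Afin : (@lebesgue_measure R A < +oo)%E by rewrite [X in (X < _)%E]A0 ltry.
have [U [oU AU mU]] := lebesgue_regularity_outer mA Afin e0.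
have mUm : measurable U by exact: open_measurable.
have muU : ((@lebesgue_measure R) U < e%:E)%E.
  rewrite -(setDUK AU) measureU//; [|exact: measurableD|exact: setDIK].
  by rewrite [X in (X + _ < _)%E]A0 add0e.
have fin x : ((@lebesgue_measure R) (U `&` `[0%R, x]) \is a fin_num)%E.
  rewrite ge0_fin_numE//; apply: le_lt_trans (lt_trans muU (ltry _)).
  by apply: le_measure; rewrite ?inE//; exact: measurableI.
pose m x := fine ((@lebesgue_measure R) (U `&` `[0%R, x])).
have mE x : (@lebesgue_measure R) (U `&` `[0%R, x]) = (m x)%:E by rewrite fineK.
have m_le x y : x <= y -> m x <= m y.
  move=> xy; rewrite -lee_fin -!mE; apply: le_measure; rewrite ?inE//.
  - exact: measurableI.
  - exact: measurableI.
  apply: setIS => z /=; rewrite !in_itv/= => /andP[-> zx].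
  exact: le_trans zx xy.
have m_lt x y : 0 <= x -> x <= y -> (forall z, x < z <= y -> U z) ->
    y - x <= m y - m x.
  move=> x0 xy zU; rewrite lerBrDl -lee_fin EFinD -!mE.
  have -> : (y - x)%:E = (@lebesgue_measure R) `]x, y].
    rewrite lebesgue_measure_itv/= lte_fin; case: ltP => // yx.
    by congr _%:E; lra.
  rewrite -measureU//; last 2 first.
  - exact: measurableI.
  - apply/seteqP; split=> // z [[_ /=]]; rewrite !in_itv/=.
    by move=> /andP[_ zx] /andP[xz _]; move: (lt_le_trans xz zx); rewrite ltxx.
  apply: le_measure; rewrite ?inE//.
  - by apply: measurableU => //; exact: measurableI.
  - exact: measurableI.
  move=> z [[Uz]|] /=; rewrite !in_itv/= => /andP[a b]; split=> //=; rewrite ?in_itv/=.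
  - by rewrite a (le_trans b).
  - by apply: zU; rewrite a.
  - by rewrite b andbT (le_trans x0)// ltW.
pose G x := e * x + L * m x.
have main : `|f t - f 0| <= G t - G 0.
  pose P x y := `|f y - f x| <= G y - G x.
  case/andP: t01 => t0 t1.
  apply: (@interval_chain P) => //.
  - by rewrite /P !subrr normr0.
  - move=> x y z Pxy Pyz; rewrite /P.
    have -> : f z - f x = (f z - f y) + (f y - f x) by ring.
    have -> : G z - G x = (G z - G y) + (G y - G x) by ring.
    exact: le_trans (ler_normD _ _) (lerD Pyz Pxy).
  move=> s /andP[s0 st].
  have s01 : s \in `[0, 1] by rewrite in_itv/= s0 (le_trans st).
  (* Inside [U] the Lipschitz bound is paid by [m], which grows there with slope one; outside [U]
     the derivative exists and is 0, so the slope [e] suffices. *)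
  have [Us|Us] := pselect (U s).
    move/open_nbhs_nbhs: (conj oU Us); move/nbhs_ballP => [d/= d0 dU].
    exists d => // u /andP[u0 ut] usd.
    have u01 : u \in `[0, 1] by rewrite in_itv/= u0 (le_trans ut).
    rewrite /P /G; split=> us.
      apply: (le_trans (Lf _ _ u01 s01)); rewrite ger0_norm ?subr_ge0//.
      have h1 := m_lt _ _ s0 us.
      have : u - s <= m u - m s.
        apply: h1 => z /andP[sz zu]; apply: dU; rewrite /ball/= distrC gtr0_norm ?subr_gt0//.
        by apply: le_lt_trans usd; rewrite ger0_norm ?subr_ge0// lerD2r.
      move/(ler_wpM2l L0); have : e * s <= e * u by rewrite ler_wpM2l// ltW.
      lra.
    apply: (le_trans (Lf _ _ s01 u01)); rewrite ger0_norm ?subr_ge0//.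
    have : s - u <= m s - m u.
      apply: m_lt => // z /andP[sz zu]; apply: dU; rewrite /ball/= ger0_norm ?subr_ge0//.
      apply: le_lt_trans usd; rewrite ler0_norm ?subr_le0// opprB lerD2l lerN2.
      exact: ltW.
    move/(ler_wpM2l L0); have : e * u <= e * s by rewrite ler_wpM2l// ltW.
    lra.
  have fs : is_derive s 1 f 0.
    have [//|nd] := pselect (is_derive s 1 f 0).
    by case: Us; apply: AU; apply: sA => /= /(_ s01).
  have df : differentiable f s by apply/derivable1_diffP; exact: ex_derive.
  have [d d0 dP] := differentiable_bound df e0.
  have {}dP u : `|u - s| < d -> `|f u - f s| <= e * `|u - s|.
    move=> us; have := dP _ us; rewrite (addrC s) subrK.
    rewrite -[X in 'D_X f s]mulr1 (_ : (u - s) * 1 = (u - s) *: (1 : R))//.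
    by rewrite (deriveZr _ _ df) derive_val scaler0 subr0.
  exists d => // u /andP[u0 ut] usd; rewrite /P /G; split=> us.
    have := dP _ usd; rewrite [`|u - s|]ger0_norm ?subr_ge0// mulrBr.
    have := ler_wpM2l L0 (m_le _ _ us); lra.
  have := dP _ usd; rewrite distrC (distrC u) [`|s - u|]ger0_norm ?subr_ge0// mulrBr.
  have := ler_wpM2l L0 (m_le _ _ us); lra.
apply: (le_trans main); rewrite /G mulr0 add0r.
have mt : m t <= e.
  rewrite -lee_fin -mE (le_trans _ (ltW muU))//.
  by apply: le_measure; rewrite ?inE//; exact: measurableI.
have m0 : 0 <= m 0 by rewrite fine_ge0.
have := ler_wpM2l L0 mt; have := mulr_ge0 L0 m0; lra.
Qed.

Definition lip01 (f : R -> R) := exists L : R, forall t u,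
  t \in `[0, 1] -> u \in `[0, 1] -> `|f t - f u| <= L * `|t - u|.

Lemma lip01_cst a : lip01 (fun=> a).
Proof. by exists 0 => t u _ _; rewrite subrr normr0 mul0r. Qed.

Lemma lip01D f g : lip01 f -> lip01 g -> lip01 (fun t => f t + g t).
Proof.
move=> [L Lf] [M Mg]; exists (L + M) => t u t01 u01.
rewrite opprD addrACA mulrDl (le_trans (ler_normD _ _))// lerD//.
  exact: Lf.
exact: Mg.
Qed.

Lemma lip01_bounded f : lip01 f ->
  exists2 B, 0 <= B & forall t, t \in `[0, 1] -> `|f t| <= B.
Proof.
move=> [L Lf]; exists (`|f 0| + `|L|) => [|t t01]; first exact: addr_ge0.
rewrite -[f t](subrK (f 0)) addrC (le_trans (ler_normD _ _))// lerD2l.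
rewrite (le_trans (Lf _ _ t01 _)) ?in_itv/= ?lexx ?ler01// subr0.
move: t01; rewrite in_itv/= => /andP[t0 t1]; rewrite ger0_norm//.
by rewrite (le_trans (ler_wpM2r t0 (ler_norm L)))// ler_piMr.
Qed.

Lemma lip01M f g : lip01 f -> lip01 g -> lip01 (fun t => f t * g t).
Proof.
move=> lf lg; have [B B0 fB] := lip01_bounded lf.
have [C C0 gC] := lip01_bounded lg; move: lf lg => [L Lf] [M Mg].
exists (B * M + C * L) => t u t01 u01.
have -> : f t * g t - f u * g u = f t * (g t - g u) + g u * (f t - f u) by ring.
rewrite (le_trans (ler_normD _ _))// !normrM mulrDl lerD// -mulrA ler_pM//.
- exact: fB.
- exact: Mg.
- exact: gC.
- exact: Lf.
Qed.

Lemma lip01_sum (I : Type) (r : seq I) (P : pred I) (f : I -> R -> R) :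
  (forall i, lip01 (f i)) -> lip01 (fun t => \sum_(i <- r | P i) f i t).
Proof.
move=> lf; elim: r => [|i r IH].
  rewrite (_ : (fun _ => _) = (fun=> 0)); first exact: lip01_cst.
  by apply/funext => t; rewrite big_nil.
rewrite (_ : (fun _ => _) = (fun t => (if P i then f i t else 0)
    + \sum_(j <- r | P j) f j t)); last first.
  by apply/funext => t; rewrite big_cons; case: ifP; rewrite ?add0r.
by apply: lip01D => //; case: (P i) => //; exact: lip01_cst.
Qed.

Lemma coord_norm_le k (x : 'rV[R]_k) i : `|x 0 i| <= `|x|.
Proof.
rewrite [leRHS]/Num.Def.normr/= mx_normrE.
exact: (le_bigmax _ (fun ij : 'I_1 * 'I_k => `|x ij.1 ij.2|) (0, i)).
Qed.

Lemma lip01_coord k (p : R -> 'rV[R]_k) i :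
  lipschitz01 p -> lip01 (fun t => p t 0 i).
Proof.
move=> [L Lp]; exists L => t u t01 u01; apply: le_trans (Lp _ _ t01 u01).
by have := coord_norm_le (p t - p u) i; rewrite !mxE.
Qed.

(** The curve stays in a closed ball, which is compact and convex: the partial derivatives are
    bounded on it, and the mean value theorem applies along its segments. *)
Lemma lip01_comp k (phi : 'rV[R]_k -> R) (p : R -> 'rV[R]_k) :
  (forall x, differentiable phi x) ->
  (forall i, continuous (fun x => 'D_(delta_mx 0 i) phi x)) ->
  lipschitz01 p -> lip01 (fun t => phi (p t)).
Proof.
move=> dphi cphi [L Lp]; pose rho := `|p 0| + `|L|.
pose B := [set x : 'rV[R]_k | `|x| <= rho].
pose g (x : 'rV[R]_k) : R := \sum_(i < k) `|'D_(delta_mx 0 i) phi x|.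
have pB t : t \in `[0, 1] -> B (p t).
  move=> t01; rewrite /B/= -[p t](subrK (p 0)) addrC.
  rewrite (le_trans (ler_normD _ _))// lerD2l.
  rewrite (le_trans (Lp _ _ t01 _)) ?in_itv/= ?lexx ?ler01// subr0.
  move: t01; rewrite in_itv/= => /andP[t0 t1]; rewrite ger0_norm//.
  by rewrite (le_trans (ler_wpM2r t0 (ler_norm L)))// ler_piMr.
have cB : compact B.
  apply: bounded_closed_compact.
    by exists rho; split; [exact: num_real|move=> M rM x /= /le_trans; apply; exact: ltW].
  rewrite (_ : B = closed_ball_ (fun x : 'rV[R]_k => `|x|) 0 rho).
    exact: closed_closed_ball_.
  by apply/seteqP; split=> x; rewrite /B/closed_ball_/= sub0r normrN.
have cg : continuous g.
  apply: continuous_big => [|i _ x]; first exact: add_continuous.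
  exact: (continuous_comp (cphi i x) (@norm_continuous _ _ _)).
have [K K0 gK] : exists2 K : R, 0 <= K & forall x, B x -> g x <= K.
  have B0 : B !=set0.
    by exists 0; rewrite /B/= normr0 addr_ge0.
  have [c cB' cmax] := EVT_max_rV B0 cB (continuous_subspaceT cg).
  exists (g c) => [|x Bx]; first by rewrite sumr_ge0.
  by apply: cmax; rewrite inE.
have key x y : B x -> B y -> `|phi y - phi x| <= K * `|y - x|.
  move=> Bx By; pose F (s : R) := phi (x + s *: (y - x)).
  pose dF (s : R) : R := 'D_(y - x) phi (x + s *: (y - x)).
  have Fd (s : R) : is_derive s 1 F (dF s) by exact: is_derive_line.
  have Fc : {within `[0, 1], continuous F}.
    by apply: derivable_within_continuous => s _; exact: ex_derive.
  have [c /[!in_itv]/= /andP[c0 c1]] := MVT ltr01 (fun s _ => Fd s) Fc.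
  rewrite /F scale1r scale0r addr0 subr0 mulr1 (addrC x) subrK => ->.
  have Bc : B (x + c *: (y - x)).
    rewrite /B/= (_ : _ + _ = (1 - c) *: x + c *: y); last first.
      by rewrite scalerBr scalerBl scale1r addrA addrAC.
    rewrite (le_trans (ler_normD _ _))// !normrZ !ger0_norm ?subr_ge0 ?(ltW c0) ?(ltW c1)//.
    have := ler_wpM2l (ltW c0) By.
    have : (1 - c) * `|x| <= (1 - c) * rho by rewrite ler_wpM2l// subr_ge0 ltW.
    lra.
  rewrite /dF derive_row// (le_trans (ler_norm_sum _ _ _))//.
  rewrite (le_trans _ (ler_wpM2r _ (gK _ Bc)))// /g mulr_suml ler_sum// => i _.
  by rewrite normrZ mulrC ler_wpM2l// coord_norm_le.
exists (K * L) => t u t01 u01.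
rewrite (le_trans (key _ _ (pB _ u01) (pB _ t01)))// -mulrA ler_wpM2l//.
exact: Lp.
Qed.

End LipschitzCurves.

(** * Lie groups in global coordinates *)

Section LieGroups.
Context {R : realType}.

Lemma derive_affine (V W : normedModType R) (f : V -> W) (z w : V) (a : W) :
  (forall h : R, f (h *: w + z) = h *: a + f z) -> 'D_w f z = a.
Proof.
move=> fE; apply: lim_near_cst => //; near=> h.
have h0 : h != 0 by near: h; exact: nbhs_dnbhs_neq.
by rewrite /= fE addrK scalerA mulVf// scale1r.
Unshelve. all: by end_near. Qed.

Lemma differentiable_row_mx (V : normedModType R) j k
    (f : V -> 'rV[R]_j) (g : V -> 'rV[R]_k) x :
  differentiable f x -> differentiable g x ->
  differentiable (fun y => row_mx (f y) (g y)) x.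
Proof.
move=> /differentiable_rowP df /differentiable_rowP dg.
apply/differentiable_rowP => i; rewrite -(splitK i); case: (fintype.split i) => i' /=.
  rewrite (_ : (fun _ => _) = (fun y => f y 0 i'))//.
  by apply/funext => y; rewrite row_mxEl.
rewrite (_ : (fun _ => _) = (fun y => g y 0 i'))//.
by apply/funext => y; rewrite row_mxEr.
Qed.

Lemma derive_row_mx (V : normedModType R) j k
    (f : V -> 'rV[R]_j) (g : V -> 'rV[R]_k) x v :
  differentiable f x -> differentiable g x ->
  'D_v (fun y => row_mx (f y) (g y)) x = row_mx ('D_v f x) ('D_v g x).
Proof.
move=> df dg; apply/rowP => i.
apply: etrans (diff_derive_coord v i (differentiable_row_mx df dg)) _.
rewrite -(splitK i); case: (fintype.split i) => i' /=.
  rewrite row_mxEl (_ : (fun _ => _) = (fun y => f y 0 i')).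
    exact/esym/diff_derive_coord.
  by apply/funext => y; rewrite row_mxEl.
rewrite row_mxEr (_ : (fun _ => _) = (fun y => g y 0 i')).
  exact/esym/diff_derive_coord.
by apply/funext => y; rewrite row_mxEr.
Qed.

Lemma differentiable_const (V W : normedModType R) (a : W) (x : V) :
  differentiable (fun=> a) x.
Proof. exact: differentiable_cst. Qed.

Lemma differentiable_idfun (V : normedModType R) (x : V) :
  differentiable (fun y => y) x.
Proof. exact: ex_diff. Qed.

Lemma smooth_twice_diff (V W : normedModType R) (f : V -> W) :
  smooth f -> twice_diff f.
Proof. by move=> sf; split=> [x|v x]; [exact: (sf [::])|exact: (sf [:: v])]. Qed.

Lemma smooth_derive (V W : normedModType R) (f : V -> W) v :
  smooth f -> twice_diff (fun x => 'D_v f x).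
Proof. by move=> sf; split=> [x|u x]; [exact: (sf [:: v])|exact: (sf [:: u; v])]. Qed.

Section Law.
Context (k : nat) (mul : 'rV[R]_k -> 'rV[R]_k -> 'rV[R]_k)
  (inv : 'rV[R]_k -> 'rV[R]_k) (lie : lie_group_law mul inv).

Let mulA x y z : mul x (mul y z) = mul (mul x y) z.
Proof. by case: lie. Qed.
Let mul0 x : mul 0 x = x. Proof. by case: lie => _ /(_ x)[]. Qed.
Let mulx0 x : mul x 0 = x. Proof. by case: lie => _ /(_ x)[]. Qed.
Let mulV x : mul (inv x) x = 0. Proof. by case: lie => _ _ /(_ x)[]. Qed.
Let mulxV x : mul x (inv x) = 0. Proof. by case: lie => _ _ /(_ x)[]. Qed.

(** With the product as one map on pairs, left- and right-invariant fields are directional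
    derivatives of a single smooth map. *)
Let m2 (z : 'rV[R]_(k + k)) := mul (lsubmx z) (rsubmx z).
Let m2E x y : m2 (row_mx x y) = mul x y.
Proof. by rewrite /m2 row_mxKl row_mxKr. Qed.
Let sm2 : smooth m2. Proof. by case: lie. Qed.
Let tm2 : twice_diff m2. Proof. exact: smooth_twice_diff. Qed.
Let dm2 z : differentiable m2 z. Proof. by case: tm2. Qed.
Let dinv x : differentiable inv x.
Proof. by case: lie => _ _ _ _ /smooth_twice_diff[]. Qed.

Let ddm2 v z : differentiable (fun y => 'D_v m2 y) z. Proof. by case: tm2. Qed.
Let dpairr (g : 'rV[R]_k) (x : 'rV[R]_k) : differentiable (fun y => row_mx g y) x.
Proof. exact: differentiable_row_mx (differentiable_const _ _) (differentiable_idfun _). Qed.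
Let dpairl (g : 'rV[R]_k) (x : 'rV[R]_k) : differentiable (fun y => row_mx y g) x.
Proof. exact: differentiable_row_mx (differentiable_idfun _) (differentiable_const _ _). Qed.

Let derive_mul (f g : 'rV[R]_k -> 'rV[R]_k) x v :
  differentiable f x -> differentiable g x ->
  'D_v (fun y => mul (f y) (g y)) x
  = 'D_(row_mx ('D_v f x) ('D_v g x)) m2 (row_mx (f x) (g x)).
Proof.
move=> df dg.
rewrite (_ : (fun y => mul _ _) = (fun y => m2 (row_mx (f y) (g y)))); last first.
  by apply/funext => y; rewrite m2E.
apply: etrans (derive_comp v (differentiable_row_mx df dg) (dm2 _)) _.
by rewrite derive_row_mx.
Qed.

Let derive_mulr g x v :
  'D_v (mul g) x = 'D_(row_mx 0 v) m2 (row_mx g x).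
Proof.
apply: etrans (derive_mul v (differentiable_const g x) (differentiable_idfun x)) _.
by rewrite derive_cst derive_id.
Qed.

Let derive_mull g x v :
  'D_v (fun y => mul y g) x = 'D_(row_mx v 0) m2 (row_mx x g).
Proof.
apply: etrans (derive_mul v (differentiable_idfun x) (differentiable_const g x)) _.
by rewrite derive_cst derive_id.
Qed.

Lemma twice_diff_mul g : twice_diff (mul g).
Proof.
split=> [x|v x].
  rewrite (_ : mul g = (fun y => m2 (row_mx g y))).
    exact: (differentiable_comp (dpairr _ _) (dm2 _)).
  by apply/funext => y; rewrite m2E.
rewrite (_ : (fun _ => _) = (fun y => 'D_(row_mx 0 v) m2 (row_mx g y))).
  exact: (differentiable_comp (dpairr _ _) (ddm2 _ _)).
by apply/funext => y; rewrite derive_mulr.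
Qed.

Let dmul g x : differentiable (mul g) x.
Proof. by case: (twice_diff_mul g). Qed.

Lemma linvE w x : linv mul w x = 'D_(row_mx 0 w) m2 (row_mx x 0).
Proof. exact: derive_mulr. Qed.

Lemma twice_diff_linv w : twice_diff (linv mul w : 'rV[R]_k -> 'rV[R]_k).
Proof.
rewrite (_ : linv mul w = (fun y => 'D_(row_mx 0 w) m2 (row_mx y 0))); last first.
  by apply/funext => y; exact: linvE.
have [d1 d2] := smooth_derive (row_mx 0 w) sm2.
have dr := dpairl 0.
split=> [x|v x].
  exact: (differentiable_comp (dr x) (d1 _)).
rewrite (_ : (fun _ => _) = (fun y => 'D_(row_mx v 0)
   (fun z => 'D_(row_mx 0 w) m2 z) (row_mx y 0))).
  exact: (differentiable_comp (dr x) (d2 _ _)).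
apply/funext => y; apply: etrans (derive_comp v (dr y) (d1 _)) _.
have := derive_row_mx v (differentiable_idfun y)
  (differentiable_const (0 : 'rV[R]_k) y).
by rewrite derive_cst derive_id => ->.
Qed.

Lemma differentiable_linv w x : differentiable (linv mul w) x.
Proof. by case: (twice_diff_linv w). Qed.

Lemma linv0 w : linv mul w 0 = w.
Proof.
rewrite /linv (_ : mul 0 = (fun y => y)) ?derive_id//.
by apply/funext => y; rewrite mul0.
Qed.

Lemma linvD u w x : linv mul (u + w) x = linv mul u x + linv mul w x.
Proof. exact: deriveDr. Qed.

Lemma linvZ a u x : linv mul (a *: u) x = a *: linv mul u x.
Proof. exact: deriveZr. Qed.

Lemma linv_sum (I : Type) (r : seq I) (P : pred I) (u : I -> 'rV[R]_k) x :
  linv mul (\sum_(i <- r | P i) u i) x = \sum_(i <- r | P i) linv mul (u i) x.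
Proof. exact: derive_sumr. Qed.

Lemma differentiable_linv_param (V : normedModType R) (f g : V -> 'rV[R]_k) x :
  differentiable f x -> differentiable g x ->
  differentiable (fun y => linv mul (f y) (g y)) x.
Proof.
move=> df dg.
rewrite (_ : (fun y => _) = (fun y => 'D_(row_mx 0 (f y)) m2 (row_mx (g y) 0))).
  apply: differentiable_deriveX => //; apply: differentiable_row_mx => //;
    exact: differentiable_const.
by apply/funext => y; exact: linvE.
Qed.

Lemma derive_linv_param (V : normedModType R) (f g : V -> 'rV[R]_k) x v :
  differentiable f x -> differentiable g x ->
  'D_v (fun y => linv mul (f y) (g y)) x
  = linv mul ('D_v f x) (g x) + 'D_('D_v g x) (linv mul (f x)) (g x).
Proof.
move=> df dg.
have dX := differentiable_row_mx (differentiable_const (0 : 'rV[R]_k) x) df.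
have dp := differentiable_row_mx dg (differentiable_const (0 : 'rV[R]_k) x).
have lE w : linv mul w = (fun y => 'D_(row_mx 0 w) m2 (row_mx y 0)).
  by apply/funext => y; exact: linvE.
rewrite (_ : (fun y => linv _ _ _)
  = (fun y => 'D_(row_mx 0 (f y)) m2 (row_mx (g y) 0))); last first.
  by apply/funext => y; exact: linvE.
apply: etrans (derive_deriveX v tm2 dX dp) _; apply: (congr2 (fun a b => a + b)).
  by rewrite linvE derive_row_mx ?derive_cst//; exact: differentiable_const.
have := derive_row_mx v dg (differentiable_const (0 : 'rV[R]_k) x).
rewrite derive_cst => ->; rewrite (lE (f x)).
apply: etrans _ (esym (derive_comp _ (dpairl 0 (g x)) (ddm2 (row_mx 0 (f x)) _))).
have := derive_row_mx ('D_v g x) (differentiable_idfun (g x))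
  (differentiable_const (0 : 'rV[R]_k) (g x)).
by rewrite derive_cst derive_id => ->.
Qed.

Lemma derive_linv_mul g w x :
  'D_(linv mul w x) (mul g) x = linv mul w (mul g x).
Proof.
rewrite /linv (_ : mul (mul g x) = (fun y => mul g (mul x y))); last first.
  by apply/funext => y; rewrite mulA.
have := @derive_comp R _ _ _ (mul x) (mul g) 0 w (dmul x 0) (dmul g _).
by rewrite mulx0 => ->.
Qed.

Lemma linv_inj x : injective (fun w => linv mul w x).
Proof.
move=> u w /= uw; rewrite -[u]linv0 -[w]linv0 -(mulV x) -!derive_linv_mul.
by rewrite uw.
Qed.

(** Left translation by [x] relates each left-invariant field to itself, hence also their bracket,
    which is thus determined by its value at the identity. *)
Lemma vfbr_linv a b x :
  vfbr (linv mul a) (linv mul b) x = linv mul (lie_br mul a b) x.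
Proof.
have := @vfbr_related R k k (mul x) (linv mul a) (linv mul b) (linv mul a)
  (linv mul b) 0 (twice_diff_mul x) (differentiable_linv _ _)
  (differentiable_linv _ _) (differentiable_linv _ _) (differentiable_linv _ _).
rewrite mulx0 => H.
exact: esym (H (derive_linv_mul x a) (derive_linv_mul x b)).
Qed.

Lemma lie_brDl a b d : lie_br mul (a + b) d = lie_br mul a d + lie_br mul b d.
Proof.
have E : linv mul (a + b) = (fun y => linv mul a y + linv mul b y).
  by apply/funext => y; exact: linvD.
apply: etrans (_ : _ = ('D_(linv mul (a + b) 0) (linv mul d) 0
  - 'D_(linv mul d 0) (linv mul (a + b)) 0)) _; first by [].
rewrite (linvD a b 0) (deriveDr _ _ (differentiable_linv d 0)) E.
have -> := deriveD (diff_derivable (differentiable_linv a 0))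
  (diff_derivable (differentiable_linv b 0)).
rewrite opprD addrACA; reflexivity.
Qed.

Lemma lie_brZl a b d : lie_br mul (a *: b) d = a *: lie_br mul b d.
Proof.
have E : linv mul (a *: b) = (fun y => a *: linv mul b y).
  by apply/funext => y; exact: linvZ.
apply: etrans (_ : _ = ('D_(linv mul (a *: b) 0) (linv mul d) 0
  - 'D_(linv mul d 0) (linv mul (a *: b)) 0)) _; first by [].
rewrite (linvZ a b 0) (deriveZr _ _ (differentiable_linv d 0)) E.
rewrite (diff_deriveZ _ _ (differentiable_linv b 0)) -scalerBr; reflexivity.
Qed.

Lemma lie_brC a b : lie_br mul a b = - lie_br mul b a.
Proof. by rewrite /lie_br /vfbr opprB. Qed.

Lemma lie_br0l d : lie_br mul 0 d = 0.
Proof. by rewrite -[X in lie_br mul X](scale0r 0) lie_brZl scale0r. Qed.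

Lemma lie_br_suml (I : Type) (r : seq I) (P : pred I) (u : I -> 'rV[R]_k) d :
  lie_br mul (\sum_(i <- r | P i) u i) d = \sum_(i <- r | P i) lie_br mul (u i) d.
Proof.
exact: (big_morph (lie_br mul ^~ d) (fun a b => lie_brDl a b d) (lie_br0l d)).
Qed.

Lemma lie_br_jacobi a b d : lie_br mul (lie_br mul a b) d =
  lie_br mul a (lie_br mul b d) - lie_br mul b (lie_br mul a d).
Proof.
have E u w : linv mul (lie_br mul u w) = vfbr (linv mul u) (linv mul w).
  by apply/funext => y; exact/esym/vfbr_linv.
have F u v w : lie_br mul u (lie_br mul v w)
    = vfbr (linv mul u) (vfbr (linv mul v) (linv mul w)) 0.
  by rewrite -E.
rewrite F F (_ : lie_br mul _ d
    = vfbr (vfbr (linv mul a) (linv mul b)) (linv mul d) 0); last by rewrite -E.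
by apply: vfbr_jacobi; exact: twice_diff_linv.
Qed.

(** * Right-invariant fields and the adjoint representation *)

Definition rinv (w : 'rV[R]_k) : vfield k := fun g => 'D_w (fun y => mul y g) 0.

Lemma rinvE w x : rinv w x = 'D_(row_mx w 0) m2 (row_mx 0 x).
Proof. exact: derive_mull. Qed.

Lemma differentiable_rinv w x : differentiable (rinv w) x.
Proof.
rewrite (_ : rinv w = (fun y => 'D_(row_mx w 0) m2 (row_mx 0 y))).
  exact: (differentiable_comp (dpairr _ _) (ddm2 _ _)).
by apply/funext => y; rewrite rinvE.
Qed.

Let dmull g x : differentiable (fun y => mul y g) x.
Proof.
rewrite (_ : (fun y => _) = (fun y => m2 (row_mx y g))).
  exact: (differentiable_comp (dpairl _ _) (dm2 _)).
by apply/funext => y; rewrite m2E.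
Qed.

Lemma rinv_mul w x y :
  rinv w (mul x y) = 'D_(row_mx (rinv w x) 0) m2 (row_mx x y).
Proof.
rewrite -derive_mull /rinv.
rewrite (_ : (fun z => mul z (mul x y)) = (fun z => mul (mul z x) y)); last first.
  by apply/funext => z; rewrite mulA.
have := @derive_comp R _ _ _ (fun z => mul z x) (fun z => mul z y) 0 w
  (dmull x 0) (dmull y _).
by rewrite mul0 => ->.
Qed.

(** By associativity both sides are the mixed second derivative of the product at [(x, 0)], in the
    directions [(rinv w x, 0)] and [(0, a)]. *)
Lemma linv_rinv_comm a w x :
  'D_(linv mul a x) (rinv w) x = 'D_(rinv w x) (linv mul a) x.
Proof.
have E1 : 'D_(linv mul a x) (rinv w) x
    = 'D_a (fun y => 'D_(row_mx (rinv w x) 0) m2 (row_mx x y)) 0.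
  rewrite (_ : (fun y => 'D_(row_mx _ 0) m2 _) = (fun y => rinv w (mul x y))).
    have := @derive_comp R _ _ _ (mul x) (rinv w) 0 a (dmul x 0)
      (differentiable_rinv w _).
    by rewrite mulx0 => ->.
  by apply/funext => y; rewrite rinv_mul.
rewrite E1 (_ : linv mul a = (fun y => 'D_(row_mx 0 a) m2 (row_mx y 0))); last first.
  by apply/funext => y; exact: linvE.
apply: etrans (derive_comp _ (dpairr x 0) (ddm2 (row_mx (rinv w x) 0) _)) _.
apply: etrans _ (esym (derive_comp _ (dpairl 0 x) (ddm2 (row_mx 0 a) _))).
have -> : 'D_a (fun y : 'rV[R]_k => row_mx x y) 0 = row_mx 0 a.
  have := derive_row_mx a (differentiable_const x (0 : 'rV[R]_k)) (differentiable_idfun _).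
  by rewrite derive_cst derive_id.
have -> : 'D_(rinv w x) (fun y : 'rV[R]_k => row_mx y (0 : 'rV[R]_k)) x
    = row_mx (rinv w x) 0.
  have := derive_row_mx (rinv w x) (differentiable_idfun x)
    (differentiable_const (0 : 'rV[R]_k) _).
  by rewrite derive_cst derive_id.
exact: derive_symm.
Qed.

(* [Ad(x^-1) w]: the right-invariant field [rinv w] in the left-invariant frame. *)
Definition Ad_inv (w x : 'rV[R]_k) : 'rV[R]_k := 'D_(rinv w x) (mul (inv x)) x.

Lemma linv_frame w x : linv mul ('D_w (mul (inv x)) x) x = w.
Proof.
rewrite /linv.
have := @derive_comp R _ _ _ (mul (inv x)) (mul x) x w (dmul _ _) (dmul _ _).
rewrite mulV => <-; rewrite (_ : (fun y => _) = (fun y => y)) ?derive_id//.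
by apply/funext => y; rewrite mulA mulxV mul0.
Qed.

Lemma linv_Ad_inv w x : linv mul (Ad_inv w x) x = rinv w x.
Proof. exact: linv_frame. Qed.

Lemma Ad_inv0 w : Ad_inv w 0 = w.
Proof.
rewrite -[LHS]linv0 linv_Ad_inv /rinv (_ : (fun _ => _) = (fun y => y)) ?derive_id//.
by apply/funext => y; rewrite mulx0.
Qed.

Lemma differentiable_Ad_inv w x : differentiable (Ad_inv w) x.
Proof.
rewrite (_ : Ad_inv w = (fun y => 'D_(row_mx 0 (rinv w y)) m2 (row_mx (inv y) y))).
  apply: differentiable_deriveX => //; apply: differentiable_row_mx.
  - exact: differentiable_const.
  - exact: differentiable_rinv.
  - exact: dinv.
  - exact: differentiable_idfun.
by apply/funext => y; exact: derive_mulr.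
Qed.

(** Differentiate [rinv w y = linv (Ad_inv w y) y] along [linv a]. Since the two kinds of fields
    commute, what remains is the bracket of [linv a] with the left-invariant field frozen at
    [beta]. *)
Lemma derive_Ad_inv w a x :
  'D_(linv mul a x) (Ad_inv w) x = lie_br mul (Ad_inv w x) a.
Proof.
apply: (@linv_inj x) => /=; rewrite -vfbr_linv; set v := linv mul a x.
set beta := Ad_inv w x.
suff E : 'D_v (rinv w) x = linv mul ('D_v (Ad_inv w) x) x + 'D_v (linv mul beta) x.
  apply: etrans (_ : _ = 'D_v (rinv w) x - 'D_v (linv mul beta) x) _.
    by rewrite E addrK.
  by rewrite /v linv_rinv_comm -linv_Ad_inv.
rewrite (_ : rinv w = (fun y => linv mul (Ad_inv w y) y)); last first.
  by apply/funext => y; rewrite linv_Ad_inv.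
have did : 'D_v (fun y : 'rV[R]_k => y) x = v by exact: derive_id.
exact: etrans (derive_linv_param v (differentiable_Ad_inv w x) (differentiable_idfun x))
  (congr1 (fun z => linv mul _ x + 'D_z (linv mul beta) x) did).
Qed.

Let differentiable_lie_br (u w : 'rV[R]_k -> 'rV[R]_k) x :
  differentiable u x -> differentiable w x ->
  differentiable (fun y => lie_br mul (u y) (w y)) x.
Proof.
move=> /differentiable_rowP du /differentiable_rowP dw.
rewrite (_ : (fun _ => _) = \sum_(i < k) (fun y => u y 0 i *:
   (\sum_(j < k) (fun y => w y 0 j *: lie_br mul (delta_mx 0 i) (delta_mx 0 j))) y)).
  apply: differentiable_sum => i; apply: differentiable_scale (du i) _.
  apply: differentiable_sum => j.
  exact: differentiable_scale (dw j) (differentiable_const _ x).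
apply/funext => y; rewrite fct_sumE {1}(row_sum_delta (u y)) lie_br_suml.
apply: eq_bigr => i _; rewrite lie_brZl fct_sumE lie_brC.
rewrite {1}(row_sum_delta (w y)) lie_br_suml -sumrN; congr (_ *: _).
by apply: eq_bigr => j _; rewrite lie_brZl (lie_brC (delta_mx 0 j)) scalerN opprK.
Qed.

(** Bootstrap: by the preceding equation the derivative in a direction [v] is the bracket of
    [Ad_inv] with the left-invariant coordinates of [v], and both are differentiable. The resulting
    continuity of derivatives makes [Ad_inv] Lipschitz along [kappa]. *)
Lemma twice_diff_Ad_inv w : twice_diff (Ad_inv w).
Proof.
split=> [x|v x]; first exact: differentiable_Ad_inv.
rewrite (_ : (fun _ => _) = (fun y => lie_br mul (Ad_inv w y) ('D_v (mul (inv y)) y))).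
  apply: differentiable_lie_br; first exact: differentiable_Ad_inv.
  rewrite (_ : (fun _ => _) = (fun y => 'D_(row_mx 0 v) m2 (row_mx (inv y) y))).
    apply: (differentiable_comp (differentiable_row_mx (dinv x) _) (ddm2 _ _)).
    exact: differentiable_idfun.
  by apply/funext => y; exact: derive_mulr.
apply/funext => y; rewrite -derive_Ad_inv linv_frame; reflexivity.
Qed.

End Law.
End LieGroups.

(** * Hall bases *)

Section HallStrings.
Context (r s n : nat) (deg : nat -> nat) (par : nat -> nat * nat).
Hypotheses (hb : hall_basis r s n deg par) (r_gt0 : (0 < r)%N).
Local Open Scope nat_scope.

Let str := hstring r par.

Lemma hall_deg_gt0 l : l < n -> 0 < deg l.
Proof.
case: hb => d1 _ _ dm _ ln; rewrite -(d1 0 r_gt0).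
by rewrite (leq_trans _ (dm 0 l _)).
Qed.

(** Degrees are positive and nondecreasing in the index, so a factor, having smaller degree than its
    bracket, comes earlier. Recursion along [par] is therefore well founded. *)
Lemma hall_par_lt l : r <= l < n ->
  [/\ (par l).2 < (par l).1, (par l).1 < l, (par l).1 < n, (par l).2 < l & (par l).2 < n].
Proof.
move=> rln; case: (hb) => _ dp _ dm _; have [/andP[ba an] dl _] := dp _ rln.
have bn := ltn_trans ba an; have al : (par l).1 < l.
  rewrite ltnNge; apply/negP => la.
  have := dm l (par l).1; rewrite la an => /(_ isT).
  by rewrite dl leqNgt -[ltnLHS]addn0 ltn_add2l hall_deg_gt0.
by split=> //; exact: ltn_trans al.
Qed.

Lemma hstring_aux_fuel f l : l < n -> l < f ->
  hstring_aux r par f l = hstring r par l.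
Proof.
rewrite /hstring; elim/ltn_ind: l f => l IH [//|f] ln lf /=.
case: ltnP => // rl; have [ba al an _ bn] := hall_par_lt (introT andP (conj rl ln)).
congr rcons; rewrite (IH _ al f an) ?(leq_trans al)//.
by rewrite (IH _ al l an).
Qed.

Lemma hstring_gen l : l < r -> str l = [:: l].
Proof. by rewrite /str /hstring /= => ->. Qed.

Lemma hstring_par l : r <= l < n -> str l = rcons (str (par l).1) (par l).2.
Proof.
move=> rln; have [_ al an _ _] := hall_par_lt rln; case/andP: (rln) => rl ln.
by rewrite {1}/str /hstring/= ltnNge rl/= hstring_aux_fuel.
Qed.

Lemma hstring_size l : 0 < size (str l).
Proof.
by rewrite /str /hstring /=; case: ifP => // _; rewrite size_rcons.
Qed.

Lemma hstring_mem l j : l < n -> j \in str l -> j < n.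
Proof.
elim/ltn_ind: l => l IH ln; have [lr|rl] := ltnP l r.
  by rewrite hstring_gen// inE => /eqP ->.
have rln : r <= l < n by rewrite rl.
have [_ al an _ bn] := hall_par_lt rln.
by rewrite hstring_par// mem_rcons inE => /predU1P[->//|]; exact: IH.
Qed.

(** A string determines its last letter and the string of the first factor, hence the pair of
    factors; an admissible pair occurs only once in the basis. *)
Lemma hstring_inj k l : k < n -> l < n -> str k = str l -> k = l.
Proof.
elim/ltn_ind: k l => k IH l kn ln.
have [kr|rk] := ltnP k r; have [lr|rl] := ltnP l r.
- by rewrite !hstring_gen// => -[].
- have rln : r <= l < n by rewrite rl.
  rewrite hstring_gen// (hstring_par rln) => /(congr1 size).
  by rewrite size_rcons /= => -[] /eqP; rewrite eq_sym -leqn0 leqNgt hstring_size.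
- have rkn : r <= k < n by rewrite rk.
  rewrite (hstring_gen lr) (hstring_par rkn) => /(congr1 size).
  by rewrite size_rcons /= => -[] /eqP; rewrite -leqn0 leqNgt hstring_size.
have rkn : r <= k < n by rewrite rk.
have rln : r <= l < n by rewrite rl.
have [ba ak an _ _] := hall_par_lt rkn; have [_ _ an' _ _] := hall_par_lt rln.
rewrite (hstring_par rkn) (hstring_par rln) => /rcons_inj[/(IH _ ak _ an an') e1 e2].
have [_ dp ds _ ex] := hb; have [_ dk hk] := dp _ rkn.
have [|||l0 [_ uniq0]] := ex (par k).1 (par k).2.
- by rewrite ba.
- by rewrite -dk ds.
- by case: (ltnP (par k).1 r) => [?|/hk]; [left|right].
rewrite -(uniq0 k); last by rewrite rkn -surjective_pairing.
by apply: uniq0; rewrite rln e1 e2 -surjective_pairing.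
Qed.

Lemma prefix_hstring_par l k : l < n -> k < n -> prefix (str l) (str k) -> k != l ->
  r <= k /\ prefix (str l) (str (par k).1).
Proof.
move=> ln kn lk kl; have [kr|rk] := ltnP k r.
  move: lk; rewrite (hstring_gen kr) prefixE => /eqP.
  case E : (str l) (hstring_size l) => [//|a u] _ /= [ak].
  move=> ut; case/eqP: kl; apply: hstring_inj => //.
  by rewrite (hstring_gen kr) E -ak -ut; case: (size u).
split=> //; have rkn : r <= k < n by rewrite rk.
move/prefixP: lk => [u]; rewrite (hstring_par rkn).
elim/last_ind: u => [|u z _].
  rewrite cats0 -(hstring_par rkn) => /(hstring_inj kn ln) E.
  by rewrite E eqxx in kl.
by rewrite -rcons_cat => /rcons_inj[-> _]; exact: prefix_prefix.
Qed.

Lemma prefix_hstring_le l k : l < n -> k < n -> prefix (str l) (str k) -> l <= k.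
Proof.
move=> ln; elim/ltn_ind: k => k IH kn lk.
have [->//|kl] := eqVneq k l.
have [rk pk] := prefix_hstring_par ln kn lk kl.
have [|_ ak an _ _] := hall_par_lt (l := k); first by rewrite rk.
exact: leq_trans (IH _ ak an pk) (ltnW ak).
Qed.

(** Descending through first factors from [k], one meets a bracket [[Y_l, Y_z]] just before [l];
    then [z < l] is the ordering of its two factors. *)
Lemma drop_hstring_head l k : l < n -> k < n -> prefix (str l) (str k) -> k != l ->
  exists z d, drop (size (str l)) (str k) = z :: d /\ z < l.
Proof.
move=> ln; elim/ltn_ind: k => k IH kn lk kl.
have [rk pk] := prefix_hstring_par ln kn lk kl.
have rkn : r <= k < n by rewrite rk.
have [ba ak an _ _] := hall_par_lt rkn.
have [u Eu] := prefixP pk; rewrite (hstring_par rkn).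
have -> : drop (size (str l)) (rcons (str (par k).1) (par k).2)
    = rcons (drop (size (str l)) (str (par k).1)) (par k).2.
  by rewrite Eu rcons_cat !drop_size_cat.
have [e|ne] := eqVneq (par k).1 l.
  by rewrite e drop_size; exists (par k).2, [::]; split=> //; rewrite -e.
have [z [d [-> zl]]] := IH _ ak an pk ne.
by exists z, (rcons d (par k).2).
Qed.

(** The last Hall condition compares consecutive second factors. The leading generator is no second
    factor, hence [behead]. *)
Lemma hstring_sorted k : k < n -> sorted leq (behead (str k)).
Proof.
elim/ltn_ind: k => k IH kn; have [kr|rk] := ltnP k r; first by rewrite hstring_gen.
have rkn : r <= k < n by rewrite rk.
have [ba ak an _ _] := hall_par_lt rkn; have := IH _ ak an.
rewrite (hstring_par rkn); have [ar|ra] := ltnP (par k).1 r.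
  by rewrite (hstring_gen ar).
have ran : r <= (par k).1 < n by rewrite ra.
have [_ dp _ _ _] := hb; have [_ _ /(_ ra) le2] := dp _ rkn.
rewrite (hstring_par ran).
case: (str (par (par k).1).1) (hstring_size (par (par k).1).1) => //= a u _.
case: u => [|b u] /=; first by rewrite le2.
by rewrite !rcons_path last_rcons => /andP[-> ->]; rewrite le2.
Qed.

Lemma drop_hstring_sorted l k : k < n -> sorted leq (drop (size (str l)) (str k)).
Proof.
move=> kn; have := hstring_size l; case: (size _) => // j _.
by rewrite -[j.+1]addn1 -drop_drop drop1; apply/drop_sorted/hstring_sorted.
Qed.

Lemma hstring_deg k : k < n -> \sum_(z <- str k) deg z = deg k.
Proof.
elim/ltn_ind: k => k IH kn; have [kr|rk] := ltnP k r.
  by rewrite hstring_gen// big_seq1.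
have rkn : r <= k < n by rewrite rk.
have [_ ak an _ _] := hall_par_lt rkn; have [_ dp _ _ _] := hb.
have [_ -> _] := dp _ rkn.
by rewrite (hstring_par rkn) -cats1 big_cat/= big_seq1 IH.
Qed.

End HallStrings.

(** * Hall-Grayson-Grossman vector fields *)

Section HallFields.
Context {R : realType}.

(** Only the line through [x] matters, so a field known on a slice alone can be differentiated in
    directions tangent to it. *)
Lemma derive_ext_line (V W : normedModType R) (f g : V -> W) (x v : V) :
  (forall t : R, f (t *: v + x) = g (t *: v + x)) -> 'D_v f x = 'D_v g x.
Proof.
move=> fg; have fgx : f x = g x by have := fg 0; rewrite scale0r add0r.
rewrite /derive (_ : (fun h : R => h^-1 *: ((f \o shift x) (h *: v) - f x))
  = (fun h : R => h^-1 *: ((g \o shift x) (h *: v) - g x)))//.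
by apply/funext => t /=; rewrite fg fgx.
Qed.

Lemma derive_along_line (V W : normedModType R) (f : V -> W) (x v : V) :
  'D_v f x = 'D_1 (fun t : R => f (t *: v + x)) (0 : R).
Proof.
rewrite /derive (_ : (fun h : R => h^-1 *: ((f \o shift x) (h *: v) - f x))
  = (fun h : R => h^-1 *: (((fun t : R => f (t *: v + x)) \o shift 0) (h *: 1)
      - f (0 *: v + x))))//.
by apply/funext => t /=; rewrite addr0 scale0r add0r [t *: 1]mulr1.
Qed.

Context (n : nat).
Implicit Types (x : 'rV[R]_n) (a : {ffun 'I_n -> nat}) (d : seq nat).

Definition count_vec d : {ffun 'I_n -> nat} := [ffun j : 'I_n => count_mem (val j) d].

(** Signed divided powers: a partial derivative lowers one exponent and changes the sign, which
    cancels the minus sign of the bracket. *)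
Definition mcoef a x : R := (-1) ^+ mabs a / mfact a * mono x a.

Lemma differentiable_mcoef a x : differentiable (mcoef a) x.
Proof.
rewrite (_ : mcoef a = cst ((-1) ^+ mabs a / mfact a) *
    \prod_(j < n) (fun y : 'rV[R]_n => y 0 j) ^+ a j); last first.
  by apply/funext => y; rewrite mulrfctE fct_prodE; congr (_ * _);
    apply: eq_bigr => j _; rewrite exprfctE.
apply: differentiableM; first exact: differentiable_cst.
elim/big_rec: _ => [|j f _ df]; first exact: differentiable_cst.
apply: differentiableM => //; case: (a j) => [|m]; first exact: differentiable_cst.
exact/differentiableX/differentiable_coord.
Qed.

Lemma mcoef0 (j : 'I_n) a x : (0 < a j)%N -> x 0 j = 0 -> mcoef a x = 0.
Proof.
by move=> aj xj; rewrite /mcoef /mono (bigD1 j)//= xj expr0n gtn_eqF// mul0r mulr0.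
Qed.

Lemma mcoef_nil x : mcoef (count_vec [::]) x = 1.
Proof.
rewrite /mcoef /mabs /mfact /mono !big1 => [|j _|j _|j _]; rewrite ?ffunE//=.
by rewrite expr0 divr1 mulr1.
Qed.

Lemma derive_mcoef0 (b : 'I_n) a x : a b = 0%N ->
  'D_(delta_mx 0 b) (mcoef a) x = 0.
Proof.
move=> ab; rewrite (derive_ext_line (g := cst (mcoef a x))) ?derive_cst// => t /=.
rewrite /mcoef /mono; congr (_ * _); apply: eq_bigr => j _; rewrite !mxE eqxx/=.
have [->|jb] := eqVneq j b; first by rewrite ab !expr0.
by rewrite mulr0 add0r.
Qed.

Lemma derive_mcoef (b : 'I_n) a a' x : a b = (a' b).+1 ->
  (forall j, j != b -> a j = a' j) ->
  'D_(delta_mx 0 b) (mcoef a) x = - mcoef a' x.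
Proof.
move=> ab aj; rewrite derive_along_line.
pose K := (-1) ^+ mabs a / mfact a * \prod_(j < n | j != b) x 0 j ^+ a j.
rewrite (_ : (fun t : R => _) = (fun t : R => K * (t + x 0 b) ^+ (a' b).+1)); last first.
  apply/funext => t; rewrite /mcoef /mono (bigD1 b)//= !mxE !eqxx mulr1 ab /K.
  rewrite -[RHS]mulrA; congr (_ * _); rewrite mulrC; congr (_ * _).
  apply: eq_bigr => j jb.
  by rewrite !mxE (negbTE jb) mulr0 add0r.
have -> : 'D_1 (fun t : R => K * (t + x 0 b) ^+ (a' b).+1) (0 : R)
    = K * ((a' b).+1%:R * x 0 b ^+ a' b).
  have d1 : is_derive (0 : R) 1 (fun t : R => t + x 0 b) 1.
    by apply: is_derive_eq; rewrite addr0.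
  have dX := is_deriveX (a' b).+1 d1.
  rewrite (_ : (fun t : R => _) = (fun t : R => K *: ((fun t => t + x 0 b) ^+ (a' b).+1) t)).
    rewrite diff_deriveZ; last by apply/derivable1_diffP; exact: ex_derive.
    by rewrite (derive_val (is_derive := dX)) /= add0r /GRing.scale/= mulr1.
  by apply/funext => t; rewrite exprfctE.
rewrite /mcoef /K.
have -> : mabs a = (mabs a').+1.
  rewrite /mabs (bigD1 b)//= [in RHS](bigD1 b)//= ab addSn.
  by congr (_ + _).+1; exact: eq_bigr.
have -> : mfact a = (a' b).+1%:R * mfact a' :> R.
  rewrite /mfact (bigD1 b)//= [in RHS](bigD1 b)//= ab factS natrM -!mulrA.
  by congr (_ * (_ * _)); apply: eq_bigr => j jb; rewrite aj.
have -> : mono x a' = x 0 b ^+ a' b * \prod_(j < n | j != b) x 0 j ^+ a j.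
  rewrite /mono (bigD1 b)//=; congr (_ * _).
  by apply: eq_bigr => j jb; rewrite aj.
rewrite exprS; field. rewrite nat1r pnatr_eq0 andbT.
by apply/prodf_neq0 => j _; rewrite pnatr_eq0 -lt0n fact_gt0.
Qed.

Context (r s : nat) (deg : nat -> nat) (par : nat -> nat * nat).
Hypotheses (hb : hall_basis r s n deg par) (r_gt0 : (0 < r)%N).
Let str := hstring r par.
Let Y := hgg (R := R) n r par.

Lemma hgg_aux_fuel f l : (l < n)%N -> (l < f)%N -> hgg_aux n r par f l = Y l.
Proof.
rewrite /Y /hgg; elim/ltn_ind: l f => l IH [//|f] ln lf /=.
case: ltnP => [//|rl].
have [ba al an bl bn] := hall_par_lt hb r_gt0 (introT andP (conj rl ln)).
have e c f' : (c < l)%N -> (c < n)%N -> (l <= f')%N ->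
    hgg_aux (R := R) n r par f' c = hgg_aux n r par c.+1 c.
  by move=> cl cn lf'; exact: IH _ cl f' cn (leq_trans cl lf').
apply: (congr2 vfbr).
  exact: etrans (e _ _ al an lf) (esym (e _ _ al an (leqnn l))).
exact: etrans (e _ _ bl bn lf) (esym (e _ _ bl bn (leqnn l))).
Qed.

Lemma hgg_gen_lt l : (l < r)%N -> Y l = hgg_gen n r par l.
Proof. by rewrite /Y /hgg /= => ->. Qed.

Lemma hgg_par l : (r <= l < n)%N -> Y l = vfbr (Y (par l).1) (Y (par l).2).
Proof.
move=> rln; case/andP: (rln) => rl ln.
have [ba al an bl bn] := hall_par_lt hb r_gt0 rln.
rewrite {1}/Y /hgg /= ltnNge rl /=.
by apply: (congr2 vfbr); exact: hgg_aux_fuel.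
Qed.

(* On the slice where the coordinates below [(par l).2] vanish, [Y_l] keeps the
   shape of the generators; differentiating this along [Y_b = d/dx_b] yields
   the same statement for brackets. *)
Let slice_form l := forall x,
  ((r <= l)%N -> forall j : 'I_n, (j < (par l).2)%N -> x 0 j = 0) ->
  Y l x = \sum_(k < n | prefix (str l) (str k))
    mcoef (count_vec (drop (size (str l)) (str k))) x *: delta_mx 0 k.

Let unit_form l := forall (ln : (l < n)%N) x,
  (forall j : 'I_n, (j < l)%N -> x 0 j = 0) ->
  Y l x = delta_mx 0 (Ordinal ln).

(** Every component other than [l] has a coefficient divisible by some [x_z] with [z < l], which
    vanishes here. *)
Let unit_of_slice l : (l < n)%N -> slice_form l -> unit_form l.
Proof.
move=> ln sl ln' x x0; rewrite sl => [|rl j jl]; last first.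
  apply: x0; apply: ltn_trans jl _.
  by have [] := hall_par_lt hb r_gt0 (introT andP (conj rl ln)).
rewrite (bigD1 (Ordinal ln'))/= ?prefix_refl// drop_size mcoef_nil scale1r.
rewrite big1 ?addr0// => k /andP[pk kl].
have [z [d [-> zl]]] := drop_hstring_head hb r_gt0 ln (ltn_ord k) pk kl.
rewrite (@mcoef0 (Ordinal (ltn_trans zl ln))) ?scale0r//; last exact: x0.
by rewrite ffunE /= eqxx.
Qed.

Let slice_gen l : (l < r)%N -> slice_form l.
Proof.
move=> lr x _; rewrite hgg_gen_lt// /hgg_gen -/str; apply: eq_bigr => k _.
rewrite /str hstring_gen//= drop1; congr (_ *: _).
Qed.

Let slice_par l : (r <= l < n)%N -> slice_form (par l).1 -> unit_form (par l).2 ->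
  slice_form l.
Proof.
move=> rln sa ub x x0; rewrite hgg_par//.
have [ba al an bl bn] := hall_par_lt hb r_gt0 rln.
case/andP: (rln) => rl ln; have {}x0 := x0 rl.
have sax (y : 'rV[R]_n) : (forall j : 'I_n, (j < (par l).2)%N -> y 0 j = 0) ->
    Y (par l).1 y = \sum_(k < n | prefix (str (par l).1) (str k))
    mcoef (count_vec (drop (size (str (par l).1)) (str k))) y *: delta_mx 0 k.
  move=> y0; apply: sa => ra j ja; apply: y0.
  have [_ dp _ _ _] := hb; have [_ _ /(_ ra) le2] := dp _ rln.
  exact: leq_trans le2.
set a := (par l).1 in sa sax *; set b := (par l).2 in ub x0 ba bl bn sax *.
(* The components of [Y a] sit at indices at least [a > b]: [Y a x] is tangent to the slice, on
   which [Y b] is constant, so half of the bracket vanishes. *)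
have Ya0 (j : 'I_n) : (j < b)%N -> (Y a x) 0 j = 0.
  move=> jb; rewrite sax// summxE big1// => k pk; rewrite !mxE eqxx /=.
  have ak := prefix_hstring_le hb r_gt0 an (ltn_ord k) pk.
  have [jk|_] := eqVneq j k; last by rewrite mulr0.
  by move: ak; rewrite -jk leqNgt (ltn_trans jb ba).
have D1 : 'D_(Y a x) (Y b) x = 0.
  rewrite (derive_ext_line (g := cst (delta_mx 0 (Ordinal bn)))) ?derive_cst//.
  move=> t; rewrite (ub bn)// => j jb.
  by rewrite !mxE x0// Ya0// mulr0 addr0.
have D2 : 'D_(Y b x) (Y a) x = - \sum_(k < n | prefix (str l) (str k))
    mcoef (count_vec (drop (size (str l)) (str k))) x *: delta_mx 0 k.
  rewrite (ub bn)//.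
  rewrite (derive_ext_line (g := \sum_(k < n) (fun y =>
     (if prefix (str a) (str k) then mcoef (count_vec (drop (size (str a)) (str k))) y
     else 0) *: delta_mx 0 k))); last first.
    move=> t; rewrite sax => [|j jb].
      rewrite fct_sumE [LHS]big_mkcond; apply: eq_bigr => k _.
      by case: ifP; rewrite ?scale0r.
    by rewrite !mxE x0// eqxx /= (_ : j == _ = false) ?mulr0 ?addr0// -val_eqE/= ltn_eqF.
  have dk (k : 'I_n) (y : 'rV[R]_n) : differentiable (fun y : 'rV[R]_n =>
     (if prefix (str a) (str k) then mcoef (count_vec (drop (size (str a)) (str k))) y
     else 0)) y.
    by case: (prefix _ _); [exact: differentiable_mcoef|exact: differentiable_const].
  rewrite derive_sum; last first.
    by move=> k; apply/diff_derivable/differentiable_scale => //; exact: differentiable_const.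
  rewrite -sumrN [RHS]big_mkcond; apply: eq_bigr => k _.
  rewrite (derive_scale _ (dk k x) (differentiable_const _ x)).
  rewrite derive_cst scaler0 add0r.
  have strl : str l = rcons (str a) b by rewrite /str (hstring_par hb r_gt0 rln).
  case: (boolP (prefix (str a) (str k))) => pak; last first.
    rewrite derive_cst scale0r; case: ifP => // plk; case/negP: pak.
    by apply: prefix_trans plk; rewrite strl prefix_rcons.
  case: ifPn => plk.
    rewrite -scaleNr; congr (_ *: _); rewrite strl in plk *.
    have [u ->] := prefixP plk; rewrite [in RHS]drop_size_cat// cat_rcons drop_size_cat//.
    apply: derive_mcoef; first by rewrite !ffunE /= eqxx.
    by move=> j jb; rewrite !ffunE /= (_ : (b == j) = false) ?add0n//;
    apply: contraNF jb => /eqP jb; apply/eqP/val_inj.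
  (* Now [u] does not begin with [b]. Being sorted, it either omits [b], and the derivative is 0, or
     begins with some [z < b], and the factor [x_z] survives differentiation and vanishes on the
     slice. *)
  have [u Eu] := prefixP pak; rewrite Eu drop_size_cat//.
  have us : sorted leq u.
    have := drop_hstring_sorted hb r_gt0 a (ltn_ord k).
    by rewrite -/str Eu drop_size_cat.
  have [bu|bu] := boolP (b \in u); last first.
    by rewrite derive_mcoef0 ?scale0r// ffunE /=; apply/count_memPn.
  case: u => [//|z u] in Eu us bu *.
  have zb : (z < b)%N.
    rewrite ltn_neqAle; apply/andP; split.
      apply: contra plk => /eqP zb; rewrite strl Eu zb -cat_rcons.
      exact: prefix_prefix.
    move: us bu => /=; rewrite inE => /(order_path_min leq_trans)/allP zu.
    by case/predU1P => [->//|/zu].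
  pose bb := Ordinal bn.
  pose a' := [ffun j : 'I_n => (count_vec (z :: u) j - (j == bb))%N].
  rewrite (@derive_mcoef bb _ a').
  - rewrite (@mcoef0 (Ordinal (ltn_trans zb bn))) ?oppr0 ?scale0r//; last exact: x0.
    by rewrite !ffunE /= eqxx -val_eqE /= (ltn_eqF zb) subn0.
  - by rewrite !ffunE eqxx subn1 prednK// -has_count has_pred1.
  - by move=> j jb; rewrite !ffunE (negbTE jb) subn0.
by rewrite /vfbr -/a -/b D1 D2 sub0r opprK.
Qed.

Let slice_unit l : (l < n)%N -> slice_form l /\ unit_form l.
Proof.
elim/ltn_ind: l => l IH ln.
suff sl : slice_form l by split=> //; exact: unit_of_slice.
have [lr|rl] := ltnP l r; first exact: slice_gen.
have rln : (r <= l < n)%N by rewrite rl.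
have [ba al an bl bn] := hall_par_lt hb r_gt0 rln.
by apply: slice_par => //; [exact: (IH _ al an).1|exact: (IH _ bl bn).2].
Qed.

Lemma hgg_slice l (ln : (l < n)%N) x :
  (forall j : 'I_n, (j < l)%N -> x 0 j = 0) -> Y l x = delta_mx 0 (Ordinal ln).
Proof. exact: (slice_unit ln).2. Qed.

(** * Homogeneity under the dilation of factor 2, whose powers separate degrees *)

Definition dilation x : 'rV[R]_n := \row_(j < n) (2 ^+ deg j * x 0 j).

Lemma dilationD x y : dilation (x + y) = dilation x + dilation y.
Proof. by apply/rowP => j; rewrite !mxE mulrDr. Qed.

Lemma dilationZ (c : R) x : dilation (c *: x) = c *: dilation x.
Proof. by apply/rowP => j; rewrite !mxE mulrCA. Qed.

Lemma differentiable_dilation x : differentiable dilation x.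
Proof.
apply/differentiable_rowP => i.
rewrite (_ : (fun _ => _) = cst (2 ^+ deg i) * (fun y : 'rV[R]_n => y 0 i)).
  apply: differentiableM; first exact: differentiable_cst.
  exact: differentiable_coord.
by apply/funext => y; rewrite mxE mulrfctE.
Qed.

Lemma derive_dilation x v : 'D_v dilation x = dilation v.
Proof. by apply: derive_affine => t; rewrite dilationD dilationZ. Qed.

Definition homogeneous p (X : vfield n) :=
  forall x, 2 ^+ p *: X (dilation x) = dilation (X x).

Let derive_homogeneous q (Z : vfield n) x v :
  (forall y, differentiable Z y) -> homogeneous q Z ->
  2 ^+ q *: 'D_(dilation v) Z (dilation x) = dilation ('D_v Z x).
Proof.
move=> dZ hZ; have dd := differentiable_dilation x.
have e1 := derive_comp v dd (dZ (dilation x)).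
rewrite derive_dilation in e1; rewrite -e1.
have dc : differentiable (fun y => Z (dilation y)) x.
  exact: (differentiable_comp dd (dZ _)).
rewrite -(diff_deriveZ _ _ dc).
rewrite (_ : (fun y => _ *: _) = (fun y => dilation (Z y))); last exact/funext.
apply: etrans (derive_comp v (dZ x) (differentiable_dilation _)) _.
exact: derive_dilation.
Qed.

Lemma homogeneous_vfbr p q (X Z : vfield n) :
  (forall y, differentiable X y) -> (forall y, differentiable Z y) ->
  homogeneous p X -> homogeneous q Z -> homogeneous (p + q) (vfbr X Z).
Proof.
move=> dX dZ hX hZ x.
have e p' q' (X' Z' : vfield n) : (forall y, differentiable Z' y) ->
    homogeneous p' X' -> homogeneous q' Z' ->
    2 ^+ (p' + q') *: 'D_(X' (dilation x)) Z' (dilation x)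
    = dilation ('D_(X' x) Z' x).
  move=> dZ' hX' hZ'; rewrite exprD mulrC -scalerA -(deriveZr _ _ (dZ' _)) hX'.
  exact: derive_homogeneous.
rewrite {1}/vfbr scalerBr (e p q X Z dZ hX hZ) addnC (e q p Z X dX hZ hX).
by rewrite /vfbr dilationD -(scaleN1r ('D_(Z x) X x)) dilationZ scaleN1r.
Qed.

(** The letters of the string of [k] have degrees adding up to [deg k], so in a generator the
    coefficient of [d/dx_k] has weight [deg k - deg l]; brackets add weights. *)
Lemma homogeneous_hgg l : (forall k, (k < n)%N -> forall x, differentiable (Y k) x) ->
  (l < n)%N -> homogeneous (deg l) (Y l).
Proof.
move=> dY; elim/ltn_ind: l => l IH ln; have [lr|rl] := ltnP l r; last first.
  have rln : (r <= l < n)%N by rewrite rl.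
  have [ba al an bl bn] := hall_par_lt hb r_gt0 rln.
  have [_ dp _ _ _] := hb; have [_ -> _] := dp _ rln; rewrite hgg_par//.
  by apply: homogeneous_vfbr; [exact: dY|exact: dY|exact: IH|exact: IH].
move=> x; rewrite hgg_gen_lt// /hgg_gen; apply/rowP => i.
rewrite !mxE !summxE !mulr_sumr; apply: eq_bigr => k pk; rewrite !mxE.
have [ik|] := eqVneq i k; last by rewrite !mulr0.
rewrite eqxx !mulr1 -ik mulrCA [RHS]mulrCA; congr (_ * _).
pose u := behead (str i).
have Iu : Iidx n r par i = count_vec u by apply/ffunP => j; rewrite !ffunE.
have du : (deg l + \sum_(z <- u) deg z = deg i)%N.
  rewrite -(hstring_deg hb r_gt0 (ltn_ord i)) /u.
  move: pk; rewrite -ik (hstring_gen par lr) -/str.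
  by case: (str i) => //= z v; rewrite big_cons => /andP[/eqP <-].
have un z : z \in u -> (z < n)%N.
  by move=> /mem_behead zu; exact: (hstring_mem hb r_gt0 (ltn_ord i) zu).
rewrite Iu -du exprD -mulrA; congr (_ * _); rewrite /mono.
have -> : (\sum_(z <- u) deg z = \sum_(j < n) count_mem (val j) u * deg j)%N.
  elim: (u) un => [|z v IHv] un; first by rewrite big_nil big1.
  rewrite big_cons IHv => [|y yv]; last by rewrite un// inE yv orbT.
  have zn : (z < n)%N by rewrite un// inE eqxx.
  rewrite -[in LHS](mul1n (deg z)) (bigD1 (Ordinal zn))//= [RHS](bigD1 (Ordinal zn))//=.
  rewrite eqxx addnA -mulnDl; congr (_ + _)%N; apply: eq_bigr => j jz.
  by rewrite (_ : (z == j) = false)//; apply: contraNF jz => /eqP zj; apply/eqP/val_inj.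
rewrite -prodrXr -big_split; apply: eq_bigr => j _ /=.
by rewrite ffunE mxE exprMn mulnC exprM.
Qed.

End HallFields.

Lemma prod_seq_eq0 (S : pzRingType) (I : eqType) (t : seq I) (F : I -> S) i :
  i \in t -> F i = 0 -> \prod_(j <- t) F j = 0.
Proof.
move=> it Fi; elim: t it => // j t IH; rewrite big_cons inE => /predU1P[<-|/IH ->].
  by rewrite Fi mul0r.
by rewrite mulr0.
Qed.

Lemma prod_scalemx (R : comPzRingType) n (I : Type) (t : seq I) (f : I -> R)
    (A : I -> 'M[R]_n) :
  \prod_(i <- t) (f i *: A i) = (\prod_(i <- t) f i) *: \prod_(i <- t) A i.
Proof.
have scaleM (a b : R) (B C : 'M[R]_n) : (a *: B) *m (b *: C) = (a * b) *: (B *m C).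
  by rewrite -scalemxAl -scalemxAr scalerA.
elim: t => [|i t IH]; first by rewrite !big_nil scale1r.
by rewrite !big_cons IH; exact: scaleM.
Qed.

(** * Extremal polynomials and coordinates of the second kind *)

Section FreeGroup.
Context {R : realType} (r s n : nat) (deg : nat -> nat) (par : nat -> nat * nat)
  (mul : 'rV[R]_n -> 'rV[R]_n -> 'rV[R]_n) (inv : 'rV[R]_n -> 'rV[R]_n).
Hypotheses (hb : hall_basis r s n deg par) (r_gt0 : (0 < r)%N)
  (lie : lie_group_law mul inv)
  (hggE : forall l, (l < n)%N -> hgg n r par l = linv mul (hgg n r par l 0)).
Let Y := hgg (R := R) n r par.
Implicit Types (i j k : 'I_n) (u w x : 'rV[R]_n).

Lemma hgg_linv j : Y j = linv mul (delta_mx 0 j).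
Proof.
rewrite /Y (hggE (ltn_ord j)); congr (linv mul _).
rewrite (hgg_slice hb r_gt0 (ltn_ord j)); last by move=> i _; rewrite mxE.
by congr delta_mx; exact: val_inj.
Qed.

(** It acts on row vectors from the right, so left-nested brackets become matrix products in reading
    order. *)
Definition ad_mx j : 'M[R]_n := \matrix_i lie_br mul (delta_mx 0 i) (delta_mx 0 j).

Lemma ad_mxE u j : lie_br mul u (delta_mx 0 j) = u *m ad_mx j.
Proof.
rewrite {1}(row_sum_delta u) (lie_br_suml lie) mulmx_sum_row.
by apply: eq_bigr => i _; rewrite (lie_brZl lie) rowK.
Qed.

Let prod_enum (F : 'I_n -> 'M[R]_n) :
  \prod_(j < n) F j = \prod_(j <- enum 'I_n) F j.
Proof. by rewrite [index_enum _]unlock enumT. Qed.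

Lemma nestbr_linv u a : nestbr Y (linv mul u) a
  = linv mul (u *m \prod_(j < n) ad_mx j ^+ a j).
Proof.
rewrite /nestbr prod_enum; elim: (enum 'I_n) u => [|j t IH] u /=.
  by rewrite big_nil mulmx1.
rewrite big_cons mulmxA -IH; congr foldl.
elim: (a j) u => [|p IHp] u /=; first by rewrite mulmx1.
rewrite IHp hgg_linv; apply/funext => x.
apply: etrans (vfbr_linv lie _ _ _) _; congr (linv mul _ x).
by rewrite ad_mxE exprSr mulmxA.
Qed.

(** The defining identity is read at the identity element, where the [Y k] are the canonical
    basis. *)
Lemma struct_constsE c i (a : {ffun 'I_n -> nat}) k : struct_consts Y c ->
  c i a k = (\prod_(j < n) ad_mx j ^+ a j) i k.
Proof.
move=> /(_ i a (ltn_ord i)); rewrite hgg_linv nestbr_linv.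
move=> /(congr1 (fun Z : vfield n => Z 0 0 k)); rewrite (linv0 lie).
rewrite -rowE mxE => ->; rewrite summxE (bigD1 k)//= big1 ?addr0 => [|l lk].
  by rewrite hgg_linv (linv0 lie) !mxE !eqxx mulr1.
by rewrite hgg_linv (linv0 lie) !mxE eqxx eq_sym (negbTE lk) mulr0.
Qed.

Definition raises p (A : 'M[R]_n) := forall i k, A i k != 0 -> (deg i + p <= deg k)%N.

(** The origin is fixed by the dilation, so homogeneity of [[Y_i, Y_j]] there multiplies the [k]-th
    coordinate by [2^(deg i + deg j)] and by [2^(deg k)] with the same result. A nonzero coordinate
    forces [deg k = deg i + deg j]. *)
Lemma raises_ad_mx j : raises 1 (ad_mx j).
Proof.
move=> i k; rewrite mxE => nz.
have dY (l : nat) : (l < n)%N -> forall x, differentiable (Y l) x.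
  move=> ln x; have -> : Y l = Y (Ordinal ln) by [].
  by rewrite hgg_linv; exact: (differentiable_linv lie).
have := homogeneous_vfbr (dY i (ltn_ord i)) (dY j (ltn_ord j))
  (homogeneous_hgg hb r_gt0 dY (ltn_ord i)) (homogeneous_hgg hb r_gt0 dY (ltn_ord j)) 0.
have -> : dilation deg (0 : 'rV[R]_n) = 0 by apply/rowP => l; rewrite !mxE mulr0.
rewrite !hgg_linv (vfbr_linv lie) (linv0 lie).
move: (lie_br mul _ _) nz => z nz /rowP/(_ k); rewrite !mxE => E.
 have /eqP := mulIf nz E; rewrite -!natrX eqr_nat eqn_exp2l// => /eqP <-.
by rewrite leq_add2l (hall_deg_gt0 hb r_gt0).
Qed.

Lemma raises1 : raises 0 1%:M.
Proof.
move=> i k; rewrite mxE addn0; have [->//|_] := eqVneq i k.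
by rewrite eqxx.
Qed.

Lemma raisesM p q A B : raises p A -> raises q B -> raises (p + q) (A *m B).
Proof.
move=> rA rB i k; rewrite mxE => nz.
have [l ABl] : exists l, A i l * B l k != 0.
  apply/existsP; apply: contraNT nz; rewrite negb_exists => /forallP ABl.
  by apply/eqP/big1 => l _; have := ABl l; rewrite negbK => /eqP.
have := ABl; rewrite mulf_eq0 negb_or => /andP[/rA + /rB].
by rewrite addnA => Al; apply: leq_trans; rewrite leq_add2r.
Qed.

Lemma raisesX p A m : raises p A -> raises (m * p) (A ^+ m).
Proof.
move=> rA; elim: m => [|m IH]; first exact: raises1.
by rewrite mulSn exprS; exact: raisesM.
Qed.

Lemma raises_eq0 p A : (s <= p)%N -> raises p A -> A = 0.
Proof.
move=> sp rA; apply/matrixP => i k; rewrite mxE; apply/eqP.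
apply: contraT => /rA; have [_ _ /(_ k (ltn_ord k)) dk _ _] := hb.
have di := hall_deg_gt0 hb r_gt0 (ltn_ord i).
by rewrite leqNgt (leq_ltn_trans dk)// (leq_ltn_trans sp)// -[ltnLHS]add0n ltn_add2r.
Qed.

Lemma ad_mxX_eq0 j p : (s <= p)%N -> ad_mx j ^+ p = 0.
Proof.
by move=> sp; apply: (raises_eq0 sp); have := raisesX (m := p) (@raises_ad_mx j); rewrite muln1.
Qed.

Lemma prod_ad_mx_eq0 (a : {ffun 'I_n -> nat}) j : (s <= a j)%N ->
  \prod_(i < n) ad_mx i ^+ a i = 0.
Proof.
by move=> sj; apply: (prod_seq_eq0 (mem_index_enum j)); exact: ad_mxX_eq0.
Qed.

(** This is the whole exponential, as powers vanish from the exponent [s] on; keeping that exponent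
    makes the index type ['I_s.+1] inhabited for every [s]. *)
Definition exp_ad j (t : R) : 'M[R]_n :=
  \sum_(p < s.+1) (t ^+ p / p`!%:R) *: ad_mx j ^+ p.

(** Distributing the ordered product yields one term per multi-index with entries at most [s]. All
    others have zero structure constants, which is also what gives the sum over all multi-indices a
    finite support. *)
Lemma extremal_polyE c v i x : struct_consts Y c ->
  extremal_poly c v i x =
  ((\prod_(j < n) exp_ad j (- x 0 j)) *m (\col_k v k)) i 0.
Proof.
move=> cE; rewrite /extremal_poly.
pose tf (f : {ffun 'I_n -> 'I_s.+1}) : {ffun 'I_n -> nat} := [ffun j => val (f j)].
have tf_inj : injective tf.
  by move=> f g /ffunP fg; apply/ffunP => j; have := fg j; rewrite !ffunE => /val_inj.
rewrite (fsbigE [seq tf f | f : {ffun 'I_n -> 'I_s.+1}]) //=; first last.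
- move=> a _ na'; have na : ~ exists f, a = tf f.
    by case=> f af; move/negP: na'; apply; rewrite af map_f ?mem_enum.
  rewrite (_ : \sum_k _ = 0) ?mulr0 ?mul0r//.
  apply: big1 => k _; rewrite (struct_constsE _ _ _ cE).
  have [j sj] : exists j, (s < a j)%N.
    apply: contrapT => H; apply: na; exists [ffun j => inord (a j)].
    apply/ffunP => j; rewrite !ffunE /= inordK// ltnS leqNgt.
    by apply/negP => sj; apply: H; exists j.
  by rewrite (prod_ad_mx_eq0 (ltnW sj)) mxE mul0r.
- by rewrite map_inj_uniq ?enum_uniq.
rewrite big_map big_enum_cond/=.
have -> : \prod_(j < n) exp_ad j (- x 0 j) = \sum_(f : {ffun 'I_n -> 'I_s.+1})
   \prod_(j < n) (((- x 0 j) ^+ f j / (f j)`!%:R) *: ad_mx j ^+ f j).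
  exact: bigA_distr_bigA.
rewrite mulmx_suml summxE; apply: eq_big => [f|f _]; first by rewrite in_setT.
have -> : \prod_(j < n) (((- x 0 j) ^+ f j / (f j)`!%:R) *: ad_mx j ^+ f j)
    = (\prod_(j < n) ((- x 0 j) ^+ f j / (f j)`!%:R)) *: \prod_(j < n) ad_mx j ^+ tf f j.
  by rewrite prod_scalemx; congr (_ *: _); apply: eq_bigr => j _; rewrite ffunE.
have -> : \prod_(j < n) ((- x 0 j) ^+ f j / (f j)`!%:R)
    = (-1) ^+ mabs (tf f) / mfact (tf f) * mono x (tf f).
  rewrite big_split/= prodfV.
  have -> : \prod_(j < n) (- x 0 j) ^+ f j = (-1) ^+ mabs (tf f) * mono x (tf f).
    rewrite /mabs -prodrXr /mono -big_split; apply: eq_bigr => j _ /=.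
    by rewrite -exprMn mulN1r ffunE.
  by rewrite mulrAC; congr (_ / _ * _); apply: eq_bigr => j _; rewrite ffunE.
rewrite -scalemxAl mxE mxE mulrAC; congr (_ * _).
by apply: eq_bigr => k _; rewrite (struct_constsE _ _ _ cE) !mxE.
Qed.

End FreeGroup.

(** * The adjoint matrix as a product of exponentials *)

Section SecondKindCoordinates.
Context {R : realType}.

(** The sum is the Taylor polynomial of [phi 0] based at [u] and evaluated at 0; its derivative in
    the base point telescopes to the last term. *)
Lemma is_derive_taylor (phi : nat -> R -> R) N (t : R) :
  (forall q (u : R), is_derive u 1 (phi q) (phi q.+1 u)) ->
  is_derive t 1 (fun u => \sum_(q < N.+1) ((- u) ^+ q / q`!%:R) * phi q u)
    ((- t) ^+ N / N`!%:R * phi N.+1 t).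
Proof.
move=> dphi; elim: N => [|N IH].
  rewrite (_ : (fun u => _) = phi 0%N).
    by rewrite expr0 fact0 divr1 mul1r; exact: dphi.
  by apply/funext => u; rewrite big_ord1 expr0 fact0 divr1 mul1r.
rewrite (_ : (fun u => _) = (fun u => \sum_(q < N.+1) ((- u) ^+ q / q`!%:R) * phi q u)
    + (fun u => (N.+1`!%:R)^-1 *: (((-%R) ^+ N.+1 : R -> R) * phi N.+1) u)); last first.
  apply/funext => u; rewrite addrfctE big_ord_recr/=; congr (_ + _).
  by rewrite mulrfctE exprfctE [RHS]mulrA; congr (_ * _); rewrite mulrC.
have dN := is_deriveX N.+1 (is_deriveNid t (1 : R)).
have dM := is_deriveM dN (dphi N.+1 t).
have dZ := is_deriveZ N.+1`!%:R^-1 dM.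
apply: (is_derive_eq (is_deriveD IH dZ)).
rewrite exprfctE /GRing.scale/= factS natrM; field.
by rewrite nat1r !pnatr_eq0 -lt0n fact_gt0.
Qed.

Lemma differentiable_mulmx_coord n (A : 'M[R]_n) k (x : 'rV[R]_n) :
  differentiable (fun u : 'rV[R]_n => (u *m A) 0 k) x.
Proof.
rewrite (_ : (fun _ => _) = \sum_(l < n) (fun u : 'rV[R]_n => A l k *: u 0 l)).
  apply: differentiable_sum => l.
  exact/differentiableZ/differentiable_coord.
by apply/funext => u; rewrite fct_sumE mxE; apply: eq_bigr => l _; rewrite mulrC.
Qed.

Lemma derive_mulmx_coord n (A : 'M[R]_n) k (x v : 'rV[R]_n) :
  'D_v (fun u : 'rV[R]_n => (u *m A) 0 k) x = (v *m A) 0 k.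
Proof. by apply: derive_affine => t; rewrite mulmxDl -scalemxAl !mxE. Qed.

Context (r s n : nat) (deg : nat -> nat) (par : nat -> nat * nat)
  (mul : 'rV[R]_n -> 'rV[R]_n -> 'rV[R]_n) (inv : 'rV[R]_n -> 'rV[R]_n).
Hypotheses (hb : hall_basis r s n deg par) (r_gt0 : (0 < r)%N)
  (lie : lie_group_law mul inv)
  (hggE : forall l, (l < n)%N -> hgg n r par l = linv mul (hgg n r par l 0)).
Implicit Types (i j k : 'I_n) (u w x y : 'rV[R]_n).

(* Along the line [y + t e_p] the field [Y_p] is [e_p], so [Ad(x^-1) w] solves
   [u' = u C_p] there. *)
Lemma Ad_inv_line (p : 'I_n) y w (t : R) : (forall j, (j <= p)%N -> y 0 j = 0) ->
  Ad_inv mul inv w (y + t *: delta_mx 0 p) *m exp_ad s mul p (- t)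
  = Ad_inv mul inv w y.
Proof.
move=> y0; pose C := ad_mx mul p; pose b (u : R) := Ad_inv mul inv w (y + u *: delta_mx 0 p).
have db (u : R) : is_derive u 1 b (b u *m C).
  have dA := differentiable_Ad_inv lie w (y + u *: delta_mx 0 p).
  have dl := is_derive_line dA.
  apply: (is_derive_eq dl); rewrite -(ad_mxE lie) -(derive_Ad_inv lie).
  congr ('D_ _ _ _); rewrite -(hgg_linv hb r_gt0 hggE).
  rewrite (hgg_slice hb r_gt0 (ltn_ord p)) => [|j jp].
    by congr delta_mx; exact: val_inj.
  rewrite !mxE (y0 _ (ltnW jp)) add0r (_ : j == p = false) ?mulr0//.
  by rewrite -val_eqE/= ltn_eqF.
(* These are the successive derivatives of a coordinate of [b]; nilpotency of [C] kills the Taylor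
   remainder, so [g] is constant. *)
apply/rowP => k; pose phi q (u : R) : R := (b u *m C ^+ q) 0 k.
have dphi q (u : R) : is_derive u 1 (phi q) (phi q.+1 u).
  have := derive_comp_line (db u) (differentiable_mulmx_coord (C ^+ q) k (b u)).
  rewrite derive_mulmx_coord -mulmxA /phi exprS; exact.
pose g (u : R) : R := (b u *m exp_ad s mul p (- u)) 0 k.
have gE : g = (fun u : R => \sum_(q < s.+1) ((- u) ^+ q / q`!%:R) * phi q u).
  apply/funext => u; rewrite /g /exp_ad mulmx_sumr summxE.
  by apply: eq_bigr => q _; rewrite -scalemxAr mxE.
have dg (u : R) : is_derive u 1 g 0.
  have := is_derive_taylor s u dphi; rewrite gE.
  by rewrite {2}/phi (ad_mxX_eq0 hb r_gt0 lie hggE) ?leqnSn// mulmx0 mxE mulr0.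
have -> : (Ad_inv mul inv w (y + t *: delta_mx 0 p) *m exp_ad s mul p (- t)) 0 k = g t.
  by [].
rewrite (is_derive_0_is_cst t 0 dg) /g /b scale0r addr0 oppr0.
rewrite /exp_ad big_ord_recl big1 ?addr0 => [|q _]; last first.
  by rewrite lift0 expr0n mul0r scale0r.
have -> : ad_mx mul p ^+ (@ord0 s) = 1%:M by [].
by rewrite expr0 fact0 divr1 scale1r mulmx1.
Qed.

(** Coordinates are removed in increasing order: [cut p] and [cut p.+1] differ along [e_p], and on
    that line the earlier coordinates are 0. Each removal absorbs the leftmost factor, until the
    identity is reached. *)
Lemma Ad_inv_exp w x :
  Ad_inv mul inv w x *m \prod_(j < n) exp_ad s mul j (- x 0 j) = w.
Proof.
pose cut p : 'rV[R]_n := \row_(j < n) (if (j < p)%N then 0 else x 0 j).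
have key p (t : seq 'I_n) : (p + size t = n)%N -> map val t = iota p (size t) ->
    Ad_inv mul inv w (cut p) *m \prod_(j <- t) exp_ad s mul j (- x 0 j) = w.
  elim: t p => [|j t IH] p /= pn.
    rewrite big_nil => _; rewrite (_ : cut p = 0).
      by rewrite (Ad_inv0 lie); exact: mulmx1.
    by apply/rowP => j; rewrite !mxE -[p]addn0 pn ltn_ord.
  case=> jp tE; rewrite big_cons.
  have -> : cut p = cut p.+1 + x 0 j *: delta_mx 0 j.
    apply/rowP => i; rewrite !mxE eqxx /= ltnS -jp.
    have [->|ij] := eqVneq i j; first by rewrite ltnn leqnn mulr1 add0r.
    by rewrite mulr0 addr0 ltn_neqAle -val_eqE /= in ij *; rewrite ij.
  apply: etrans (mulmxA _ _ _) _; rewrite Ad_inv_line => [|i ij].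
    by apply: IH => //; rewrite addSn -addnS.
  by rewrite mxE -jp ltnS ij.
have := key 0%N (enum 'I_n); rewrite size_enum_ord val_enum_ord => /(_ erefl erefl).
rewrite (_ : cut 0%N = x); last by apply/rowP => j; rewrite mxE.
by rewrite [index_enum _]unlock enumT.
Qed.

End SecondKindCoordinates.

(** * Homomorphisms and stratifications *)

Section Homomorphisms.
Context {R : realType} (j k : nat)
  (mulF : 'rV[R]_j -> 'rV[R]_j -> 'rV[R]_j) (invF : 'rV[R]_j -> 'rV[R]_j)
  (mulG : 'rV[R]_k -> 'rV[R]_k -> 'rV[R]_k) (invG : 'rV[R]_k -> 'rV[R]_k)
  (pi : 'rV[R]_j -> 'rV[R]_k).
Hypotheses (lieF : lie_group_law mulF invF) (lieG : lie_group_law mulG invG)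
  (spi : smooth pi) (piM : forall x y, pi (mulF x y) = mulG (pi x) (pi y)).

Let tpi : twice_diff pi. Proof. exact: smooth_twice_diff. Qed.
Let dpi x : differentiable pi x. Proof. by case: tpi. Qed.

Lemma hom0 : pi 0 = 0.
Proof.
have [mulGA mulG0 mulGV _ _] := lieG; have [_ mulF0 _ _ _] := lieF.
have E : mulG (pi 0) (pi 0) = pi 0 by rewrite -piM (mulF0 0).1.
rewrite -[LHS](mulG0 _).1 -(mulGV (pi 0)).1 -mulGA E; reflexivity.
Qed.

Lemma derive_hom_linv u x : 'D_(linv mulF u x) pi x = linv mulG ('D_u pi 0) (pi x).
Proof.
have dF := (twice_diff_mul lieF x).1 0; have dG := (twice_diff_mul lieG (pi x)).1 (pi 0).
have [_ mulF0 _ _ _] := lieF.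
have := @derive_comp R _ _ _ (mulF x) pi 0 u dF (dpi _); rewrite (mulF0 x).2 => <-.
rewrite (_ : (fun y => _) = (fun y => mulG (pi x) (pi y))); last first.
  by apply/funext => y; rewrite piM.
by apply: etrans (derive_comp u (dpi 0) dG) _; rewrite hom0.
Qed.

Lemma derive_hom_lie_br u w :
  'D_(lie_br mulF u w) pi 0 = lie_br mulG ('D_u pi 0) ('D_w pi 0).
Proof.
have := @vfbr_related R k j pi (linv mulF u) (linv mulF w) (linv mulG ('D_u pi 0))
  (linv mulG ('D_w pi 0)) 0 tpi (differentiable_linv lieF _ _)
  (differentiable_linv lieF _ _) (differentiable_linv lieG _ _)
  (differentiable_linv lieG _ _) (derive_hom_linv u) (derive_hom_linv w).
by rewrite hom0.
Qed.

End Homomorphisms.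

Section Stratifications.
Context {R : realType} (m r s : nat)
  (mul : 'rV[R]_m -> 'rV[R]_m -> 'rV[R]_m) (inv : 'rV[R]_m -> 'rV[R]_m)
  (V : nat -> {vspace 'rV[R]_m}).
Hypotheses (lie : lie_group_law mul inv) (strat : stratification r s mul V)
  (s_gt0 : (0 < s)%N).

Definition derived_layers : {vspace 'rV[R]_m} := (\sum_(k < s | (0 < k)%N) V k)%VS.

Let memVD k v : (0 < k < s)%N -> v \in V k -> v \in derived_layers.
Proof.
move=> /andP[k0 ks] vk; rewrite -[v]/(v) /derived_layers.
exact: (subvP (sumv_sup (Ordinal ks) k0 (subvv _)) _ vk).
Qed.

Let decompose v : exists2 f : 'I_s -> 'rV[R]_m,
  (forall k, f k \in V k) & v = \sum_k f k.
Proof.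
have [[_ VT] _ _ _ _] := strat.
have : v \in (\sum_(k < s) V k)%VS by rewrite VT memvf.
by move=> /memv_sumP[f fV ->]; exists f => // k; exact: fV.
Qed.

Let lie_br_layer0 a b : a \in V 0%N -> lie_br mul a b \in derived_layers.
Proof.
move=> aV; have [f fV ->] := decompose b; have [_ _ _ Vbr V0] := strat.
rewrite lie_brC memvN (lie_br_suml lie) memv_suml// => k _.
rewrite lie_brC memvN; have [ks|sk] := ltnP k.+1 s.
  have /(_ _ _ aV (fV k)) := (Vbr k ks (V k.+1)).1 (subvv _).
  by apply: memVD; rewrite ks.
have ks : k = s.-1 :> nat by apply/eqP; rewrite -eqSS prednK// eqn_leq sk ltn_ord.
by rewrite V0 ?mem0v// -ks fV.
Qed.

Let lie_br_linear b : linear (fun a => lie_br mul a b).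
Proof. by move=> t u v; rewrite (lie_brDl lie) (lie_brZl lie). Qed.

(** The layer [V k.+1] is given as the smallest subspace containing certain brackets, so the claim
    is put as an inclusion in a preimage; Jacobi then reduces it to lower layers. *)
Let lie_br_layer k a b : (k < s)%N -> a \in V k -> lie_br mul a b \in derived_layers.
Proof.
elim: k a b => [|k IH] a b ks aV; first exact: lie_br_layer0.
pose M := GRing.isLinear.Build _ _ _ _ _ (lie_br_linear b).
pose L : {linear 'rV[R]_m -> 'rV[R]_m} := HB.pack (fun a => lie_br mul a b) M.
have [_ _ _ Vbr _] := strat.
suff : (V k.+1 <= linfun L @^-1: derived_layers)%VS.
  by move=> /subvP/(_ _ aV); rewrite -memv_preim lfunE.
apply/(Vbr k ks) => a0 c a0V cV; rewrite -memv_preim lfunE /= (lie_br_jacobi lie).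
apply: memvB; first exact: lie_br_layer0.
by apply: IH => //; exact: ltnW.
Qed.

Lemma lie_br_derived a b : lie_br mul a b \in derived_layers.
Proof.
have [f fV ->] := decompose a; rewrite (lie_br_suml lie) memv_suml// => k _.
exact: lie_br_layer.
Qed.

Lemma dim_derived_layers : (r + \dim derived_layers <= m)%N.
Proof.
have [[dV VT] Vr _ _ _] := strat.
have dm : \dim (fullv : {vspace 'rV[R]_m}) = m by rewrite dimvf /dim /= mul1n.
rewrite -[X in (_ <= X)%N]dm -VT (directvP dV) /= (bigD1 (Ordinal s_gt0))//= Vr leq_add2l.
have -> : derived_layers = (\sum_(k < s | k != Ordinal s_gt0) V k)%VS.
  by apply: eq_bigl => k; rewrite lt0n.
exact: dimv_leq_sum.
Qed.

(* Only the first layer survives modulo [derived_layers], so at least [r] of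
   the basis vectors must have index below [r]. *)
Lemma basis_first_layer (w : nat -> 'rV[R]_m) (sidx : nat -> nat) (n : nat) :
  (0 < r)%N -> (forall l, (r <= l < n)%N -> w l \in derived_layers) ->
  (forall j, (j < m)%N -> (sidx j < n)%N) ->
  (forall j k, (j < k < m)%N -> (sidx j < sidx k)%N) ->
  basis_of fullv [seq w (sidx j) | j <- iota 0 m] ->
  forall j, (j < r)%N -> (j < m)%N /\ sidx j = j.
Proof.
move=> r0 wD sn smono /andP[/eqP wspan _].
have rm : (r <= m)%N by apply: leq_trans dim_derived_layers; exact: leq_addr.
have inc j d : (j + d < m)%N -> (sidx j + d <= sidx (j + d))%N.
  elim: d => [|d IH] jd; first by rewrite !addn0.
  rewrite addnS (leq_ltn_trans (IH _)) ?smono//.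
    by rewrite (leq_trans _ jd)// addnS.
  by rewrite addnS leqnn (leq_trans _ jd)// addnS.
have last_lt : (sidx r.-1 < r)%N.
  rewrite ltnNge; apply/negP => rs.
  pose W := <<[seq w (sidx j) | j <- iota 0 r.-1]>>%VS.
  have full : (fullv <= W + derived_layers)%VS.
    rewrite -wspan; apply/span_subvP => _ /mapP[j + ->].
    rewrite mem_iota add0n /= => jm; have [jr|rj] := ltnP j r.-1.
      apply: (subvP (addvSl _ _)); apply: memv_span; apply: map_f.
      by rewrite mem_iota.
    apply: (subvP (addvSr _ _)); apply: wD; rewrite sn// andbT.
    move: rj; rewrite leq_eqVlt => /predU1P[<-//|rj].
    by rewrite (leq_trans rs)// ltnW// smono// rj.
  have := leq_trans (dimvS full) (dimv_add_leqif _ _).1.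
  have -> : \dim (fullv : {vspace 'rV[R]_m}) = m by rewrite dimvf /dim /= mul1n.
  have Wr : (\dim W <= r.-1)%N.
    by rewrite (leq_trans (dim_span _))// size_map size_iota.
  move=> /leq_trans/(_ (leq_add Wr (leqnn _)))/(leq_trans dim_derived_layers).
  by rewrite leq_add2r leqNgt prednK// leqnn.
move=> j jr; have jm := leq_trans jr rm; split=> //; apply/eqP.
have r1m : (r.-1 < m)%N by rewrite prednK.
have jr1 : (j <= r.-1)%N by rewrite -ltnS prednK.
(* A strictly increasing sequence is squeezed: from below by its start at 0, from above by its value
   at [r.-1]. *)
rewrite eqn_leq; apply/andP; split; last first.
  by rewrite (leq_trans _ (inc 0%N j _)) ?leq_addl.
have := inc j (r.-1 - j)%N; rewrite subnKC// => /(_ r1m) /leq_ltn_trans/(_ last_lt).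
rewrite -[X in (_ < X)%N](prednK r0) ltnS -{2}(subnKC jr1) leq_add2r.
by [].
Qed.

End Stratifications.

(** * Dual curves *)

Section DualCurves.
Context {R : realType} (m : nat)
  (mul : 'rV[R]_m -> 'rV[R]_m -> 'rV[R]_m) (inv : 'rV[R]_m -> 'rV[R]_m).
Hypothesis lie : lie_group_law mul inv.

Lemma dotvDr (x y z : 'rV[R]_m) : dotv x (y + z) = dotv x y + dotv x z.
Proof. by rewrite /dotv -big_split; apply: eq_bigr => i _; rewrite mxE mulrDr. Qed.

Lemma dotvNr (x y : 'rV[R]_m) : dotv x (- y) = - dotv x y.
Proof. by rewrite /dotv -sumrN; apply: eq_bigr => i _; rewrite mxE mulrN. Qed.

Lemma dotvZr (a : R) (x y : 'rV[R]_m) : dotv x (a *: y) = a * dotv x y.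
Proof. by rewrite /dotv mulr_sumr; apply: eq_bigr => i _; rewrite mxE mulrCA. Qed.

Lemma dotv0r (x : 'rV[R]_m) : dotv x 0 = 0.
Proof. by rewrite /dotv big1// => i _; rewrite mxE mulr0. Qed.

Lemma dotv_sumr (I : Type) (t : seq I) (P : pred I) (x : 'rV[R]_m) (y : I -> 'rV[R]_m) :
  dotv x (\sum_(i <- t | P i) y i) = \sum_(i <- t | P i) dotv x (y i).
Proof. exact: (big_morph (dotv x) (dotvDr x) (dotv0r x)). Qed.

Lemma is_derive_dotv (f g : R -> 'rV[R]_m) (t : R) (f' g' : 'rV[R]_m) :
  is_derive t 1 f f' -> is_derive t 1 g g' ->
  is_derive t 1 (fun u => dotv (f u) (g u)) (dotv f' (g t) + dotv (f t) g').
Proof.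
move=> [df <-] [dg <-].
have dfi i : is_derive t 1 (fun u => f u 0 i : R) (('D_1 f t) 0 i).
  by rewrite derive_coord//; apply: DeriveDef => //; exact: derivable_coord.
have dgi i : is_derive t 1 (fun u => g u 0 i : R) (('D_1 g t) 0 i).
  by rewrite derive_coord//; apply: DeriveDef => //; exact: derivable_coord.
rewrite (_ : (fun u => _) = \sum_(i < m) ((fun u => f u 0 i : R) * (fun u => g u 0 i : R))).
  apply: (is_derive_eq (is_derive_sum (fun i => is_deriveM (dfi i) (dgi i)))).
  rewrite /dotv -big_split; apply: eq_bigr => i _ /=.
  by rewrite /GRing.scale/= addrC; congr (_ + _); rewrite mulrC.
by apply/funext => u; rewrite fct_sumE.
Qed.

(* [<xi, W>] has derivative [<xi, [linv b, W]>] for a left-invariant [W]; letting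
   the frame [om] rotate by [om' = [om, b]] cancels it. *)
Lemma is_derive_dual (xi gam om : R -> 'rV[R]_m) (b xi' : 'rV[R]_m) (t : R) :
  is_derive t 1 gam (linv mul b (gam t)) ->
  is_derive t 1 om (lie_br mul (om t) b) ->
  is_derive t 1 xi xi' ->
  (forall z, dotv xi' z = - dotv (xi t) ('D_z (linv mul b) (gam t))) ->
  is_derive t 1 (fun u => dotv (xi u) (linv mul (om u) (gam u))) 0.
Proof.
move=> [dgam Egam] [dom Eom] dxi adj.
have dom' := (derivable1_diffP _ _).1 dom.
have dgam' := (derivable1_diffP _ _).1 dgam.
pose z := linv mul (om t) (gam t).
have dz : is_derive t 1 (fun u => linv mul (om u) (gam u))
    (linv mul (lie_br mul (om t) b) (gam t)
      + 'D_(linv mul b (gam t)) (linv mul (om t)) (gam t)).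
  apply: DeriveDef.
    exact/diff_derivable/(differentiable_linv_param lie).
  apply: etrans (derive_linv_param lie (1 : R) dom' dgam') _.
  by rewrite Egam Eom.
apply: (is_derive_eq (is_derive_dotv dxi dz)); rewrite adj -dotvNr -dotvDr.
rewrite (_ : - _ + _ = 0) ?dotv0r// -(vfbr_linv lie).
have gen (A B : 'rV[R]_m) : - A + ((A - B) + B) = 0 by rewrite subrK addNr.
exact: gen.
Qed.

Lemma lip01_dual (xi gam om : R -> 'rV[R]_m) :
  lipschitz01 xi -> lipschitz01 gam -> (forall k, lip01 (fun t => om t 0 k)) ->
  lip01 (fun t => dotv (xi t) (linv mul (om t) (gam t))).
Proof.
move=> lxi lgam lom.
rewrite (_ : (fun t => _) = (fun t => \sum_(i < m) (xi t 0 i *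
   \sum_(k < m) (om t 0 k * (linv mul (delta_mx 0 k) (gam t)) 0 i)))).
  apply: lip01_sum => i; apply: lip01M; first exact: lip01_coord.
  apply: lip01_sum => k; apply: lip01M => //.
  have [df ddf] := twice_diff_coord i (twice_diff_linv lie (delta_mx 0 k)).
  apply: (@lip01_comp _ m (fun y => linv mul (delta_mx 0 k) y 0 i)) => // l x.
  exact/differentiable_continuous/ddf.
apply/funext => t; apply: eq_bigr => i _; congr (_ * _).
rewrite {1}(row_sum_delta (om t)) (linv_sum lie) summxE.
by apply: eq_bigr => k _; rewrite (linvZ lie) mxE.
Qed.

End DualCurves.

(** Coordinate-free form of the adjoint equation: the dual curve moves by minus the transposed
    differential of the controlled field, with the controls frozen. *)
Lemma dotv_adjoint (R : realType) m r (h : 'I_r -> R) (X : 'I_r -> 'rV[R]_m -> 'rV[R]_m)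
    (x y z : 'rV[R]_m) : (forall j, differentiable (X j) x) ->
  dotv (\row_(k < m) - \sum_(j < r) \sum_(i < m)
    'D_(delta_mx 0 k) (fun p => X j p 0 i) x * h j * y 0 i) z
  = - dotv y ('D_z (fun p => \sum_(j < r) h j *: X j p) x).
Proof.
move=> dX.
have -> : 'D_z (fun p => \sum_(j < r) h j *: X j p) x
    = \sum_(j < r) h j *: \sum_(k < m) z 0 k *: 'D_(delta_mx 0 k) (X j) x.
  rewrite (_ : (fun p => _) = \sum_(j < r) (fun p => h j *: X j p)); last first.
    by apply/funext => p; rewrite fct_sumE.
  rewrite derive_sum; last by move=> j; apply/derivableZ/diff_derivable.
  by apply: eq_bigr => j _; rewrite (diff_deriveZ _ _ (dX j)) (derive_row _ (dX j)).
rewrite dotv_sumr /dotv -sumrN.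
under eq_bigr => k _ do rewrite mxE mulNr mulr_suml -sumrN.
rewrite exchange_big; apply: eq_bigr => j _ /=.
under eq_bigr => k _ do rewrite mulr_suml -sumrN.
rewrite exchange_big -sumrN; apply: eq_bigr => i _ /=.
rewrite mxE summxE !mulr_sumr -sumrN; apply: eq_bigr => k _.
rewrite mxE (diff_derive_coord _ _ (dX j)); move: ('D_ _ _ _) => d.
by ring.
Qed.

Theorem theorem5p4 (R : realType) (r s m n : nat)
  (* G = R^m: a Lie group law with identity 0 *)
  (mulG : 'rV[R]_m -> 'rV[R]_m -> 'rV[R]_m) (invG : 'rV[R]_m -> 'rV[R]_m)
  (* a stratification g = g_1 (+) ... (+) g_s of rank r, step s *)
  (Vg : nat -> {vspace 'rV[R]_m})
  (* a Hall basis of the free nilpotent Lie algebra of rank r, step s, dim n *)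
  (deg : nat -> nat) (par : nat -> nat * nat)
  (* F = R^n: the free nilpotent group with left-invariant fields Y_l *)
  (mulF : 'rV[R]_n -> 'rV[R]_n -> 'rV[R]_n) (invF : 'rV[R]_n -> 'rV[R]_n)
  (* generalized structure constants *)
  (c : nat -> {ffun 'I_n -> nat} -> nat -> R)
  (* the homomorphism pi, the index set S = {sidx 0 < ... < sidx (m-1)},
     and the coefficients zeta *)
  (pi : 'rV[R]_n -> 'rV[R]_m) (sidx : nat -> nat) (zeta : nat -> nat -> R)
  (* the curve, its controls, its lift and its dual curve *)
  (gamma : R -> 'rV[R]_m) (h : nat -> R -> R) (kappa : R -> 'rV[R]_n)
  (xi : R -> 'rV[R]_m) (xi0 : R) :
  (2 <= r)%N -> (2 <= s)%N ->
  lie_group_law mulG invG ->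
  stratification r s mulG Vg ->
  hall_basis r s n deg par ->
  lie_group_law mulF invF ->
  (forall l, (l < n)%N -> hgg n r par l = linv mulF (hgg n r par l 0)) ->
  struct_consts (hgg n r par) c ->
  (* pi is a surjective Lie group homomorphism *)
  smooth pi ->
  (forall x y, pi (mulF x y) = mulG (pi x) (pi y)) ->
  (forall y, exists x, pi x = y) ->
  (* pi_* Y_i lies in g_1 for i = 1..r *)
  (forall i, (i < r)%N -> 'D_(hgg n r par i 0) pi 0 \in Vg 0%N) ->
  (* S *)
  (forall j, (j < m)%N -> (sidx j < n)%N) ->
  (forall j k, (j < k < m)%N -> (sidx j < sidx k)%N) ->
  basis_of fullv
    [seq 'D_(hgg n r par (sidx j) 0) pi 0 | j <- iota 0 m] ->
  let X : nat -> vfield m :=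
    fun j => linv mulG ('D_(hgg n r par (sidx j) 0) pi 0) in
  (forall i, (i < n)%N ->
     linv mulG ('D_(hgg n r par i 0) pi 0)
     = (fun p => \sum_(j < m) zeta i j *: X j p)) ->
  (* gamma horizontal with controls h in L^2, gamma(0) = 0 *)
  lipschitz01 gamma ->
  (forall j, (j < r)%N -> L2_01 (h j)) ->
  {ae @lebesgue_measure R, forall t : R, t \in `[0, 1] ->
     is_derive t 1 gamma (\sum_(j < r) h j t *: X j (gamma t))} ->
  gamma 0 = 0 ->
  (* kappa is the lift of gamma *)
  kappa 0 = 0 ->
  lipschitz01 kappa ->
  {ae @lebesgue_measure R, forall t : R, t \in `[0, 1] ->
     is_derive t 1 kappa (\sum_(j < r) h j t *: hgg n r par j (kappa t))} ->
  (* gamma is an extremal with dual curve xi *)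
  lipschitz01 xi ->
  (xi0 = 0 \/ xi0 = 1) ->
  (forall t, t \in `[0, 1] -> xi0 + `|xi t| != 0) ->
  (forall t j, t \in `[0, 1] -> (j < r)%N ->
     xi0 * h j t + dotv (xi t) (X j (gamma t)) = 0) ->
  {ae @lebesgue_measure R, forall t : R, t \in `[0, 1] ->
     is_derive t 1 xi
       (\row_(k < m) - \sum_(j < r) \sum_(i < m)
           'D_(delta_mx 0 k) (fun p => X j p 0 i) (gamma t) * h j t * xi t 0 i)} ->
  exists v : nat -> R,
    (forall i, (i < n)%N -> v i = \sum_(j < m) zeta i j * v (sidx j)) /\
    (forall t i, t \in `[0, 1] -> (i < m)%N ->
       dotv (xi t) (X i (gamma t)) = extremal_poly c v (sidx i) (kappa t)).
Proof.
move=> r2 s2 lieG strat hb lieF hggE cE spi piM psurj piV sn smono wbasis X zetaE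
  lgam hL2 dgam gam0 kap0 lkap dkap lxi xi01 xine ham dxi.
have r0 : (0 < r)%N := ltnW r2; have s0 : (0 < s)%N := ltnW s2.
pose Y l : 'rV[R]_n := hgg n r par l 0.
pose dpi (u : 'rV[R]_n) : 'rV[R]_m := 'D_u pi 0.
have tpi := smooth_twice_diff spi.
have dpiP (u x : 'rV[R]_n) : 'D_u dpi x = dpi u.
  apply: derive_affine => t; rewrite /dpi.
  by rewrite (deriveDr _ _ (tpi.1 0)) (deriveZr _ _ (tpi.1 0)).
have ddpi (x : 'rV[R]_n) : differentiable dpi x.
  exact: (differentiable_deriveX tpi (differentiable_idfun x) (differentiable_const 0 x)).
have dpi_br u w : dpi (lie_br mulF u w) = lie_br mulG (dpi u) (dpi w).
  exact: (derive_hom_lie_br lieF lieG spi piM).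
have Ye (k : 'I_n) : Y k = delta_mx 0 k.
  rewrite /Y; have -> := hgg_linv hb r0 hggE k; exact: (linv0 lieF).
have wD l : (r <= l < n)%N -> dpi (Y l) \in derived_layers s Vg.
  move=> rln; have [_ _ an _ bn] := hall_par_lt hb r0 rln.
  have -> : Y l = lie_br mulF (Y (par l).1) (Y (par l).2).
    rewrite /Y; have -> := hgg_par (R := R) hb r0 rln.
    have -> := hggE _ an; have -> := hggE _ bn.
    rewrite (linv0 lieF) (linv0 lieF); reflexivity.
  rewrite dpi_br; exact: (lie_br_derived lieG strat s0).
(* From here on [X j] is the image of [Y j] for [j < r], so [h] steers [gamma] and [kappa] by
   corresponding fields. *)
have sj := basis_first_layer strat s0 r0 wD sn smono wbasis.
pose v l := dotv (xi 0) (linv mulG (dpi (Y l)) (gamma 0)).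
have const w t : t \in `[0, 1] ->
    dotv (xi t) (linv mulG (dpi (Ad_inv mulF invF w (kappa t))) (gamma t))
    = dotv (xi 0) (linv mulG (dpi w) (gamma 0)).
  move=> t01; pose om t := dpi (Ad_inv mulF invF w (kappa t)).
  have lom k : lip01 (fun t => om t 0 k).
    rewrite (_ : (fun t => om t 0 k) = (fun t => \sum_(l < n)
      (Ad_inv mulF invF w (kappa t) 0 l * (dpi (delta_mx 0 l)) 0 k))).
      apply: lip01_sum => l; apply: lip01M; last exact: lip01_cst.
      have [df ddf] := twice_diff_coord l (twice_diff_Ad_inv lieF w).
      apply: (@lip01_comp _ n (fun y => Ad_inv mulF invF w y 0 l)) => // i x.
      exact/differentiable_continuous/ddf.
    apply/funext => u; rewrite /om /dpi derive_row ?summxE; last exact: (tpi.1 0).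
    by apply: eq_bigr => l _; rewrite mxE.
  have [L Lf] := lip01_dual lieG lxi lgam lom.
  have fae : {ae @lebesgue_measure R, forall u : R, u \in `[0, 1] ->
      is_derive u 1 (fun u => dotv (xi u) (linv mulG (om u) (gamma u))) 0}.
    apply: (@filterS3 _ _ (ae_filter_ringOfSetsType (@lebesgue_measure R)) _ _ _ _ _
      dgam dkap dxi) => u dg dk dx u01.
    (* The common control: [kappa] follows [linv mulF a] and [gamma] follows the left-invariant
       field of [dpi a]. *)
    pose a : 'rV[R]_n := \sum_(j < r) h j u *: Y j.
    have rn (j : 'I_r) : (j < n)%N.
      by have [jm js] := sj j (ltn_ord j); rewrite -js; exact: sn.
    have dpia : dpi a = \sum_(j < r) h j u *: dpi (Y j).
      rewrite /a /dpi (derive_sumr _ _ _ (tpi.1 0)); apply: eq_bigr => j _.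
      exact: (deriveZr _ _ (tpi.1 0)).
    have Eb p : linv mulG (dpi a) p = \sum_(j < r) h j u *: X j p.
      rewrite dpia (linv_sum lieG); apply: eq_bigr => j _.
      rewrite (linvZ lieG) /X; have [_ ->] := sj j (ltn_ord j); reflexivity.
    have {}dg : is_derive u 1 gamma (linv mulG (dpi a) (gamma u)).
      rewrite Eb; exact: dg.
    have {}dk : is_derive u 1 kappa (linv mulF a (kappa u)).
      rewrite (linv_sum lieF).
      rewrite (eq_bigr (fun j : 'I_r => h j u *: hgg n r par j (kappa u))).
        exact: dk.
      move=> j _; rewrite (linvZ lieF); have -> := hggE _ (rn j); reflexivity.
    apply: (@is_derive_dual R m mulG invG lieG xi gamma om (dpi a) _ u dg _ (dx u01)).
      have dA := differentiable_Ad_inv lieF w (kappa u).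
      have dF := differentiable_comp dA (ddpi (Ad_inv mulF invF w (kappa u))).
      apply: (is_derive_eq (derive_comp_line dk dF)).
      apply: etrans (derive_comp _ dA (ddpi _)) _.
      by rewrite dpiP (derive_Ad_inv lieF) dpi_br.
    move=> z; have -> : linv mulG (dpi a) = (fun p => \sum_(j < r) h j u *: X j p).
      by apply/funext => p; exact: Eb.
    apply: (@dotv_adjoint R m r (fun j => h j u) (fun j => X j)).
    move=> j; exact: (differentiable_linv lieG).
  apply: etrans (lipschitz_ae_derive0 Lf fae t01) _.
  by rewrite /om kap0 (Ad_inv0 lieF).
exists v; split=> [i ilt|t i t01 im].
  have E := congr1 (fun Z : vfield m => Z (gamma 0)) (zetaE i ilt).
  apply: etrans (congr1 (dotv (xi 0)) E) _.
  rewrite dotv_sumr; apply: eq_bigr => j _; exact: dotvZr.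
pose mu u : 'cV[R]_n := \col_k dotv (xi u) (linv mulG (dpi (Y k)) (gamma u)).
have muE u x : dotv (xi u) (linv mulG (dpi x) (gamma u)) = (x *m mu u) 0 0.
  rewrite {1}(row_sum_delta x) /dpi (derive_sumr _ _ _ (tpi.1 0)) (linv_sum lieG).
  rewrite dotv_sumr mxE; apply: eq_bigr => k _.
  by rewrite (deriveZr _ _ (tpi.1 0)) (linvZ lieG) dotvZr mxE Ye.
pose M := \prod_(j < n) exp_ad s mulF j (- kappa t 0 j).
pose B : 'M[R]_n := \matrix_k Ad_inv mulF invF (delta_mx 0 k) (kappa t).
have BM : B *m M = 1%:M.
  apply/row_matrixP => k; rewrite row_mul rowK row1.
  exact: (Ad_inv_exp hb r0 lieF hggE).
have Bmu : B *m mu t = mu 0.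
  apply/matrixP => k j; rewrite ord1.
  have Ek := const (delta_mx 0 k) t t01; rewrite (muE t) (muE 0) in Ek.
  have E1 : (B *m mu t) k 0 = (row k (B *m mu t)) 0 0 by rewrite [RHS]mxE.
  have E2 : mu 0 k 0 = ((delta_mx 0 k : 'rV[R]_n) *m mu 0) 0 0 by rewrite -rowE [RHS]mxE.
  rewrite E1 E2 row_mul rowK; exact: Ek.
have -> : dotv (xi t) (X i (gamma t)) = mu t (Ordinal (sn i im)) 0.
  by rewrite mxE.
have -> : extremal_poly c v (sidx i) (kappa t)
    = extremal_poly c v (Ordinal (sn i im)) (kappa t) by [].
rewrite (extremal_polyE hb r0 lieF hggE _ _ _ cE) -/M.
have -> : \col_k v k = mu 0 by apply/colP => k; rewrite !mxE.
(* [B] and [M] are square, so the left inverse is also a right inverse, and [M] recovers [mu t] from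
   [mu 0]. *)
by rewrite -Bmu mulmxA (mulmx1C BM) mul1mx.
Qed.
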